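(* In $(\mathcal M_1,\mathcal G)$, for tangent vectors $X=-f\,d\theta^3\wedge dx^{03}$ and $Y=-g\,d\theta^3\wedge dx^{03}$ at $u$ (with $f,g$ smooth zero-mean functions on $S^1$), the (unnormalised) sectional curvature is $$K(X,Y)=\frac34\Big[\int_{S^1}\frac{fQ(g)-Q(f)g}{u^2}\Big]^2\Big[\int_{S^1}u^{-1}\Big]^{-1}\ge0.$$
   Context: $S^1=\mathbb R/\mathbb Z$ (unit length) with coordinate $x=x_0$, and $\mathbb T^7=\mathbb T^3\times\mathbb T^4$ with unit-length circles. $\mathcal M_1$ is the space of closed $G_2$-structures $\varphi_u=d\theta^{123}-d\theta^1\wedge(dx^{01}+dx^{23})-d\theta^2\wedge(dx^{02}+dx^{31})-d\theta^3\wedge(u\,dx^{03}+dx^{12})$ on $\mathbb T^7$, where $u=u(x_0)>0$ is smooth with $\int_{S^1}u=1$; a tangent vector $X=-f\,d\theta^3\wedge dx^{03}$ corresponds to $\partial_tu=f$. With $F(x)=\int_0^xf$, $Q(f)=F-\big[\int_{S^1}u^{-1}F\big]\big[\int_{S^1}u^{-1}\big]^{-1}$. The metric is $\mathcal G(X,Y)=\int_{S^1}u^{-1}Q(f)Q(g)$, and its Levi-Civita connection is $D_XY=Y_t+U'\,d\theta^3\wedge dx^{03}$ with $U=\frac{fQ(g)+Q(f)g}{u}-\frac{Q(f)Q(g)u'}{u^2}$. For a two-parameter family $u(t,s)$ with $f=u_t$, $g=u_s$, the curvature is $K(X,Y)=-[\mathcal G(D_YD_XY,X)-\mathcal G(D_XD_YY,X)]$.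 *)

(* Defs.v *)
From Stdlib Require Import Reals.
From Coquelicot Require Import Coquelicot.
Open Scope R_scope.

(* Forms on [T^7 = R^7/Z^7] are handled through their lifts to the universal
    cover.  All the forms below have coefficients depending on [x0] only, so
    [Z^7]-periodicity of a form is 1-periodicity of its coefficients. *)

Inductive axis : Set := theta1 | theta2 | theta3 | x0 | x1 | x2 | x3.

Definition vec7 : Type := axis -> R.

Definition alt3 : Type := vec7 -> vec7 -> vec7 -> R.

(* The first argument is the base point. *)
Definition three_form : Type := vec7 -> alt3.

(* [di /\ dj /\ dk], normalised as a determinant. *)
Definition wedge3 (i j k : axis) : alt3 := fun v w z =>
    v i * (w j * z k - w k * z j)
  - v j * (w i * z k - w k * z i)
  + v k * (w i * z j - w j * z i).

Definition phi (u : R -> R) : three_form := fun p v w z =>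
  wedge3 theta1 theta2 theta3 v w z
  - (wedge3 theta1 x0 x1 v w z + wedge3 theta1 x2 x3 v w z)
  - (wedge3 theta2 x0 x2 v w z + wedge3 theta2 x3 x1 v w z)
  - (u (p x0) * wedge3 theta3 x0 x3 v w z + wedge3 theta3 x1 x2 v w z).

Definition tangent_form (f : R -> R) : three_form := fun p v w z =>
  - f (p x0) * wedge3 theta3 x0 x3 v w z.

Definition axis_eqb (i j : axis) : bool :=
  match i, j with
  | theta1, theta1 | theta2, theta2 | theta3, theta3
  | x0, x0 | x1, x1 | x2, x2 | x3, x3 => true
  | _, _ => false
  end.

Definition basis_vec (i : axis) : vec7 :=
  fun j => if axis_eqb i j then 1 else 0.

(* Minus the [dtheta3 /\ dx03] coefficient, as a function of [x0]: this
   recovers [u] from [phi u] and [f] from [tangent_form f]. *)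
Definition coeff (omega : three_form) : R -> R := fun x =>
  - omega (fun j => x * basis_vec x0 j)
      (basis_vec theta3) (basis_vec x0) (basis_vec x3).

Definition smooth (f : R -> R) : Prop := forall n x, ex_derive_n f n x.

Definition periodic (f : R -> R) : Prop := forall x, f (x + 1) = f x.

Definition is_density (u : R -> R) : Prop :=
  smooth u /\ periodic u /\ (forall x, 0 < u x) /\ RInt u 0 1 = 1.

Definition zero_mean (f : R -> R) : Prop :=
  smooth f /\ periodic f /\ RInt f 0 1 = 0.

Definition M1 (omega : three_form) : Prop :=
  exists u, is_density u /\ omega = phi u.

Definition primitive (f : R -> R) (x : R) : R := RInt f 0 x.

Definition Q (u f : R -> R) (x : R) : R :=
  primitive f x
  - RInt (fun y => / u y * primitive f y) 0 1 * / RInt (fun y => / u y) 0 1.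

Definition metric (omega X Y : three_form) : R :=
  let u := coeff omega in
  RInt (fun x => / u x * Q u (coeff X) x * Q u (coeff Y) x) 0 1.

Definition U (u f g : R -> R) (x : R) : R :=
  (f x * Q u g x + Q u f x * g x) / u x
  - Q u f x * Q u g x * Derive u x / (u x) ^ 2.

Definition form_deriv (Y : R -> three_form) (t : R) : three_form := fun p v w z =>
  Derive (fun tau => Y tau p v w z) t.

(* [D_X Y] for a field [Y] along the curve [omega], where [X] is the velocity
   of [omega]. *)
Definition cov_deriv (omega Y : R -> three_form) (t : R) : three_form := fun p v w z =>
  form_deriv Y t p v w z
  + Derive (U (coeff (omega t)) (coeff (form_deriv omega t)) (coeff (Y t)))
      (p x0) * wedge3 theta3 x0 x3 v w z.

(* [w] is [C^n] in [(t, s, x)] on [|t| < r, |s| < r]: all iterated partial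
   derivatives of order at most [n] exist and are jointly continuous. *)
Fixpoint Cn_near (n : nat) (r : R) (w : R -> R -> R -> R) : Prop :=
  (forall t s x, Rabs t < r -> Rabs s < r ->
     continuous (fun p : R * R * R => w (fst (fst p)) (snd (fst p)) (snd p))
       (t, s, x)) /\
  match n with
  | O => True
  | S m =>
      (forall t s x, Rabs t < r -> Rabs s < r ->
         ex_derive (fun tau => w tau s x) t /\
         ex_derive (fun sigma => w t sigma x) s /\
         ex_derive (w t s) x) /\
      Cn_near m r (fun t s x => Derive (fun tau => w tau s x) t) /\
      Cn_near m r (fun t s x => Derive (fun sigma => w t sigma x) s) /\
      Cn_near m r (fun t s x => Derive (w t s) x)
  end.

(* Smooth two-parameter family in [M1], for [(t, s)] near [(0, 0)]; the values
   of [Phi] elsewhere are irrelevant. *)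
Definition is_family (Phi : R -> R -> three_form) : Prop :=
  exists r : R, 0 < r /\
    (forall t s, Rabs t < r -> Rabs s < r -> M1 (Phi t s)) /\
    (forall n, Cn_near n r (fun t s x => coeff (Phi t s) x)).

Definition d_t (Phi : R -> R -> three_form) (t s : R) : three_form :=
  form_deriv (fun tau => Phi tau s) t.

Definition d_s (Phi : R -> R -> three_form) (t s : R) : three_form :=
  form_deriv (fun sigma => Phi t sigma) s.

Definition D_t (Phi Z : R -> R -> three_form) (t s : R) : three_form :=
  cov_deriv (fun tau => Phi tau s) (fun tau => Z tau s) t.

Definition D_s (Phi Z : R -> R -> three_form) (t s : R) : three_form :=
  cov_deriv (fun sigma => Phi t sigma) (fun sigma => Z t sigma) s.

(* With [X = d_t Phi] and [Y = d_s Phi]. *)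
Definition family_curvature (Phi : R -> R -> three_form) (t s : R) : R :=
  - (metric (Phi t s) (D_s Phi (D_t Phi (d_s Phi)) t s) (d_t Phi t s)
     - metric (Phi t s) (D_t Phi (D_s Phi (d_s Phi)) t s) (d_t Phi t s)).

Definition family_through (omega X Y : three_form) (Phi : R -> R -> three_form) : Prop :=
  is_family Phi /\ Phi 0 0 = omega /\ d_t Phi 0 0 = X /\ d_s Phi 0 0 = Y.

(* [K(X, Y) = k] at [omega].  As [K] is computed from an auxiliary family, the
   value must be the same for all families realising [X] and [Y], and there
   must be at least one. *)
Definition is_sectional_curvature (omega X Y : three_form) (k : R) : Prop :=
  (exists Phi, family_through omega X Y Phi) /\
  (forall Phi, family_through omega X Y Phi -> family_curvature Phi 0 0 = k).

(* Main.v *)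
(* Write [P = Q(u_t)], [N = Q(u_s)].  Since [U = (Q(f) Q(g) / u)'], every
   correction term of the connection is an exact second derivative in [x], and
   the third derivatives of the family cancel in [D_s D_t Y - D_t D_s Y], whose
   coefficient is therefore [- E''] with
     [E = d_s (P N / u) + N Q(D_t Y) / u - d_t (N^2 / u) - P Q(D_s Y) / u].
   As [Q(F') = F - const], the function [E] collapses to a constant times
   [N / u]: all its local terms cancel, and only the constants of [Q] survive.
   Differentiating [int P / u = int N / u = 0] along the family and integrating
   [(P N / u^2)'] and [(N^2 / u^2)'] over the circle evaluates this constant as
   [- (3/2) J / I] with [J = int (f N - P g) / u^2] and [I = int 1 / u].  Pairing
   with [P] gives another factor [J / 2]. *)

Require Import Defs.
From Stdlib Require Import Reals Lra ClassicalEpsilon FunctionalExtensionality.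
From Coquelicot Require Import Coquelicot.
Open Scope R_scope.

(** * Smooth functions of two parameters and one space variable *)

(** The obstacle is that [Q] is nonlocal: its constant is a quotient of integrals that vary with the
    parameters, so partials along the family do not commute with [Q]. They do commute after one
    derivative in [x]; each commutation error is therefore independent of [x], and such a number is
    found by integrating against [/ u]. The factor [3 / 2] is the sum of two errors: [1] from the
    difference of [Ds P] and [Dt N], and [/ 2] from [Q] of the coefficient of [D_t Y]. The
    corresponding constant for [D_s Y] is zero, because there both arguments of the antisymmetric
    integrand coincide. Covariant differentiation is iterated, and a family is constrained only on a
    square of parameters. So the smoothness calculus must be closed under products, inverses and
    integrals, and the first covariant derivatives must be known on the whole square, not only at
    the origin. *)

Definition Dt (w : R -> R -> R -> R) (t s x : R) : R :=
  Derive (fun tau => w tau s x) t.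

Definition Ds (w : R -> R -> R -> R) (t s x : R) : R :=
  Derive (fun sigma => w t sigma x) s.

Definition Dx (w : R -> R -> R -> R) (t s x : R) : R := Derive (w t s) x.

Definition continuous3 (w : R -> R -> R -> R) (t s x : R) : Prop :=
  continuous (fun p : R * R * R => w (fst (fst p)) (snd (fst p)) (snd p))
    (t, s, x).

Definition smooth_near (r : R) (w : R -> R -> R -> R) : Prop :=
  forall n, Cn_near n r w.

Lemma continuous3_eps (w : R -> R -> R -> R) (t s x : R) :
  continuous3 w t s x <->
  forall eps : posreal, exists d : posreal, forall t' s' y,
    Rabs (t' - t) < d -> Rabs (s' - s) < d -> Rabs (y - x) < d ->
    Rabs (w t' s' y - w t s x) < eps.
Proof.
  split.
  - intros H eps.
    destruct (proj1 (filterlim_locally _ _) H eps) as [d Hd].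
    exists d; intros t' s' y Ht Hs Hy.
    exact (Hd (t', s', y) (conj (conj Ht Hs) Hy)).
  - intros H.
    apply filterlim_locally; intros eps.
    destruct (H eps) as [d Hd].
    exists d; intros [[t' s'] y] [[Ht Hs] Hy].
    exact (Hd t' s' y Ht Hs Hy).
Qed.

Lemma continuous3_continuous (w : R -> R -> R -> R) (t s x : R) :
  continuous3 w t s x -> continuous (w t s) x.
Proof.
  intros H.
  apply filterlim_locally; intros eps.
  destruct (proj1 (continuous3_eps w t s x) H eps) as [d Hd].
  exists d; intros y Hy.
  apply Hd; [| | exact Hy]; rewrite Rminus_diag, Rabs_R0; apply cond_pos.
Qed.

(** Tube lemma: compactness of [[a, b]] makes the parameter radius independent of [y]. It serves
    twice, for continuity of integrals in the parameters and for positivity of perturbed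
    densities. *)
Lemma continuous3_tube (w : R -> R -> R -> R) (t s a b : R) :
  (forall y, a <= y <= b -> continuous3 w t s y) ->
  forall eps : posreal, exists d : posreal, forall t' s' y,
    Rabs (t' - t) < d -> Rabs (s' - s) < d -> a <= y <= b ->
    Rabs (w t' s' y - w t s y) < eps.
Proof.
  intros Hc eps.
  (* The compactness statement wants a radius at every real point, so points outside [[a, b]]
     receive the dummy value [eps]. *)
  assert (Hd : forall y, exists d : posreal, a <= y <= b ->
    forall t' s' z, Rabs (t' - t) < d -> Rabs (s' - s) < d ->
      Rabs (z - y) < d -> Rabs (w t' s' z - w t s y) < pos_div_2 eps).
  { intros y.
    destruct (classic (a <= y <= b)) as [Hy | Hy].
    - destruct (proj1 (continuous3_eps w t s y) (Hc y Hy) (pos_div_2 eps))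
        as [d Hd].
      exists d; intros _; exact Hd.
    - exists eps; tauto. }
  pose (delta y := proj1_sig (constructive_indefinite_description _ (Hd y))).
  assert (Hdelta : forall y, a <= y <= b ->
    forall t' s' z, Rabs (t' - t) < delta y -> Rabs (s' - s) < delta y ->
      Rabs (z - y) < delta y -> Rabs (w t' s' z - w t s y) < pos_div_2 eps).
  { intros y; exact (proj2_sig (constructive_indefinite_description _ (Hd y))). }
  (* The centre [z] near [y] comes only under a double negation, hence the detour through [NNPP].
     Both values at [y] are then compared with [w t s z], each within half of [eps]. *)
  destruct (compactness_value_1d a b delta) as [d Hcomp].
  exists d; intros t' s' y Ht Hs Hy.
  apply NNPP; intros Hneg.
  apply (Hcomp y Hy); intros (z & Hz & Hyz & Hdz).
  apply Hneg.
  pose proof (Hdelta z Hz t' s' y ltac:(lra) ltac:(lra) Hyz) as H1.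
  assert (H2 : Rabs (w t s y - w t s z) < pos_div_2 eps).
  { apply (Hdelta z Hz); [| | exact Hyz];
      rewrite Rminus_diag, Rabs_R0; apply cond_pos. }
  replace (w t' s' y - w t s y)
    with ((w t' s' y - w t s z) - (w t s y - w t s z)) by ring.
  eapply Rle_lt_trans; [apply Rabs_triang |].
  rewrite Rabs_Ropp; simpl in H1, H2; lra.
Qed.

Lemma Rabs_lt_locally (r t : R) :
  Rabs t < r -> locally t (fun tau => Rabs tau < r).
Proof.
  intros Ht.
  assert (Hpos : 0 < r - Rabs t) by lra.
  exists (mkposreal _ Hpos); intros y Hy.
  change (Rabs (y - t) < r - Rabs t) in Hy.
  replace y with (t + (y - t)) by ring.
  eapply Rle_lt_trans; [apply Rabs_triang | lra].
Qed.

(** * Closure properties of [Cn_near] *)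

Lemma Cn_near_continuous (n : nat) (r : R) (w : R -> R -> R -> R) (t s x : R) :
  Cn_near n r w -> Rabs t < r -> Rabs s < r -> continuous3 w t s x.
Proof. destruct n; intros [H _]; apply H. Qed.

Lemma Cn_near_S_elim (n : nat) (r : R) (w : R -> R -> R -> R) :
  Cn_near (S n) r w ->
  (forall t s x, Rabs t < r -> Rabs s < r ->
     is_derive (fun tau => w tau s x) t (Dt w t s x) /\
     is_derive (fun sigma => w t sigma x) s (Ds w t s x) /\
     is_derive (w t s) x (Dx w t s x)) /\
  Cn_near n r (Dt w) /\ Cn_near n r (Ds w) /\ Cn_near n r (Dx w).
Proof.
  intros [_ [Hd H]]; split; [| exact H].
  intros t s x Ht Hs.
  destruct (Hd t s x Ht Hs) as (H1 & H2 & H3).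
  split; [| split]; apply Derive_correct; assumption.
Qed.

(** Agreement on the open square of parameters passes to all partials, since [Derive] sees only a
    neighbourhood. Global equality would be too much to ask: a family is arbitrary outside the
    square. *)
Lemma Cn_near_ext (n : nat) (r : R) (w v : R -> R -> R -> R) :
  (forall t s x, Rabs t < r -> Rabs s < r -> w t s x = v t s x) ->
  Cn_near n r w -> Cn_near n r v.
Proof.
  revert w v; induction n as [| n IH]; intros w v E Hw.
  all: assert (Hc : forall t s x, Rabs t < r -> Rabs s < r -> continuous3 v t s x)
    by (intros t s x Ht Hs;
        apply continuous_ext_loc
          with (fun p : R * R * R => w (fst (fst p)) (snd (fst p)) (snd p));
        [ destruct (Rabs_lt_locally r t Ht) as [d1 Hd1];
          destruct (Rabs_lt_locally r s Hs) as [d2 Hd2];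
          exists (mkposreal _ (Rmin_stable_in_posreal d1 d2));
          intros [[t' s'] y] [[Ht' Hs'] _]; apply E; simpl;
          [ apply Hd1; eapply Rlt_le_trans; [exact Ht' | apply Rmin_l]
          | apply Hd2; eapply Rlt_le_trans; [exact Hs' | apply Rmin_r] ]
        | exact (Cn_near_continuous _ r w t s x Hw Ht Hs) ]).
  - split; [exact Hc | exact I].
  - assert (Et : forall t s x, Rabs t < r -> Rabs s < r ->
      locally t (fun tau => w tau s x = v tau s x)).
    { intros t s x Ht Hs.
      apply (filter_imp (fun tau => Rabs tau < r));
        [intros tau Htau; apply E; assumption | apply Rabs_lt_locally, Ht]. }
    assert (Es : forall t s x, Rabs t < r -> Rabs s < r ->
      locally s (fun sigma => w t sigma x = v t sigma x)).
    { intros t s x Ht Hs.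
      apply (filter_imp (fun sigma => Rabs sigma < r));
        [intros sigma Hsigma; apply E; assumption | apply Rabs_lt_locally, Hs]. }
    destruct Hw as (_ & Hd & H1 & H2 & H3).
    split; [exact Hc |].
    split; [| split; [| split]].
    + intros t s x Ht Hs.
      destruct (Hd t s x Ht Hs) as (D1 & D2 & D3).
      split; [| split].
      * exact (ex_derive_ext_loc _ _ _ (Et t s x Ht Hs) D1).
      * exact (ex_derive_ext_loc _ _ _ (Es t s x Ht Hs) D2).
      * apply ex_derive_ext with (w t s); [| exact D3].
        intros y; apply E; assumption.
    + refine (IH _ _ _ H1); intros t s x Ht Hs.
      apply Derive_ext_loc, Et; assumption.
    + refine (IH _ _ _ H2); intros t s x Ht Hs.
      apply Derive_ext_loc, Es; assumption.
    + refine (IH _ _ _ H3); intros t s x Ht Hs.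
      apply Derive_ext; intros y; apply E; assumption.
Qed.

(** Lets the partials be given in closed form, so that inductions on the order never meet a raw
    [Derive] of a composite expression. *)
Lemma Cn_near_S_intro (n : nat) (r : R) (w a b c : R -> R -> R -> R) :
  (forall t s x, Rabs t < r -> Rabs s < r -> continuous3 w t s x) ->
  (forall t s x, Rabs t < r -> Rabs s < r ->
     is_derive (fun tau => w tau s x) t (a t s x) /\
     is_derive (fun sigma => w t sigma x) s (b t s x) /\
     is_derive (w t s) x (c t s x)) ->
  Cn_near n r a -> Cn_near n r b -> Cn_near n r c -> Cn_near (S n) r w.
Proof.
  intros Hc Hd Ha Hb Hcc.
  split; [exact Hc |].
  split; [| split; [| split]].
  - intros t s x Ht Hs.
    destruct (Hd t s x Ht Hs) as (H1 & H2 & H3).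
    split; [| split]; eexists; eassumption.
  - refine (Cn_near_ext n r _ _ _ Ha); intros t s x Ht Hs.
    symmetry; apply is_derive_unique, Hd; assumption.
  - refine (Cn_near_ext n r _ _ _ Hb); intros t s x Ht Hs.
    symmetry; apply is_derive_unique, Hd; assumption.
  - refine (Cn_near_ext n r _ _ _ Hcc); intros t s x Ht Hs.
    symmetry; apply is_derive_unique, Hd; assumption.
Qed.

(** Needed for the product and inverse rules, where undifferentiated factors reappear in the
    partials and must be available at the lower order. *)
Lemma Cn_near_le (n : nat) (r : R) (w : R -> R -> R -> R) :
  Cn_near (S n) r w -> Cn_near n r w.
Proof.
  revert w; induction n as [| n IH]; intros w Hw.
  - split; [apply Hw | exact I].
  - destruct (Cn_near_S_elim _ _ _ Hw) as (Hd & H1 & H2 & H3).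
    apply Cn_near_S_intro with (Dt w) (Ds w) (Dx w); auto.
    apply Hw.
Qed.

Lemma Cn_near_const (n : nat) (r c : R) : Cn_near n r (fun _ _ _ => c).
Proof.
  revert c; induction n as [| n IH]; intros c.
  - split; [intros; apply continuous_const | exact I].
  - apply Cn_near_S_intro with (fun _ _ _ => 0) (fun _ _ _ => 0) (fun _ _ _ => 0);
      auto; intros; [apply continuous_const |].
    split; [| split]; apply @is_derive_const.
Qed.

Lemma Cn_near_t (n : nat) (r : R) : Cn_near n r (fun t _ _ => t).
Proof.
  assert (Hc : forall t s x, continuous3 (fun t _ _ => t) t s x).
  { intros t s x; apply continuous3_eps; intros eps; exists eps; auto. }
  destruct n; [split; [intros; apply Hc | exact I] |].
  apply Cn_near_S_intro with (fun _ _ _ => 1) (fun _ _ _ => 0) (fun _ _ _ => 0);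
    try apply Cn_near_const; intros; [apply Hc |].
  split; [apply @is_derive_id | split; apply @is_derive_const].
Qed.

Lemma Cn_near_s (n : nat) (r : R) : Cn_near n r (fun _ s _ => s).
Proof.
  assert (Hc : forall t s x, continuous3 (fun _ s _ => s) t s x).
  { intros t s x; apply continuous3_eps; intros eps; exists eps; auto. }
  destruct n; [split; [intros; apply Hc | exact I] |].
  apply Cn_near_S_intro with (fun _ _ _ => 0) (fun _ _ _ => 1) (fun _ _ _ => 0);
    try apply Cn_near_const; intros; [apply Hc |].
  split; [| split]; [| apply @is_derive_id |]; apply @is_derive_const.
Qed.

Lemma smooth_Derive (u : R -> R) : smooth u -> smooth (Derive u).
Proof.
  intros Hu n x.
  destruct n as [| n]; [exact I |].
  apply ex_derive_ext with (Derive_n u (S n)); [| exact (Hu (S (S n)) x)].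
  intros y.
  rewrite <- (Nat.add_1_r n); symmetry; exact (Derive_n_comp u n 1 y).
Qed.

Lemma Cn_near_x (n : nat) (r : R) (u : R -> R) :
  smooth u -> Cn_near n r (fun _ _ x => u x).
Proof.
  revert u; induction n as [| n IH]; intros u Hu.
  all: assert (Hc : forall t s x, continuous3 (fun _ _ x => u x) t s x)
    by (intros t s x; apply continuous_comp;
        [apply continuous_snd | apply (ex_derive_continuous u), (Hu 1%nat)]).
  - split; [intros; apply Hc | exact I].
  - apply Cn_near_S_intro
      with (fun _ _ _ => 0) (fun _ _ _ => 0) (fun _ _ x => Derive u x);
      try apply Cn_near_const.
    + intros; apply Hc.
    + intros t s x _ _; split; [| split];
        [apply @is_derive_const .. | apply Derive_correct, (Hu 1%nat)].
    + apply IH, smooth_Derive, Hu.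
Qed.

Lemma Cn_near_plus (n : nat) (r : R) (w v : R -> R -> R -> R) :
  Cn_near n r w -> Cn_near n r v ->
  Cn_near n r (fun t s x => w t s x + v t s x).
Proof.
  revert w v; induction n as [| n IH]; intros w v Hw Hv.
  all: assert (Hc : forall t s x, Rabs t < r -> Rabs s < r ->
      continuous3 (fun t s x => w t s x + v t s x) t s x)
    by (intros t s x Ht Hs;
        exact (continuous_plus _ _ _ (Cn_near_continuous _ _ _ t s x Hw Ht Hs)
          (Cn_near_continuous _ _ _ t s x Hv Ht Hs))).
  - split; [exact Hc | exact I].
  - destruct (Cn_near_S_elim _ _ _ Hw) as (Dw & Hw1 & Hw2 & Hw3).
    destruct (Cn_near_S_elim _ _ _ Hv) as (Dv & Hv1 & Hv2 & Hv3).
    apply Cn_near_S_intro with (fun t s x => Dt w t s x + Dt v t s x)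
      (fun t s x => Ds w t s x + Ds v t s x)
      (fun t s x => Dx w t s x + Dx v t s x); auto.
    intros t s x Ht Hs.
    destruct (Dw t s x Ht Hs) as (A1 & A2 & A3).
    destruct (Dv t s x Ht Hs) as (B1 & B2 & B3).
    split; [| split]; apply @is_derive_plus; assumption.
Qed.

Lemma is_derive_Rmult (f g : R -> R) (x df dg : R) :
  is_derive f x df -> is_derive g x dg ->
  is_derive (fun y => f y * g y) x (df * g x + f x * dg).
Proof. intros Hf Hg; apply (is_derive_mult f g); auto; exact Rmult_comm. Qed.

Lemma is_derive_Rminus (f g : R -> R) (x df dg : R) :
  is_derive f x df -> is_derive g x dg ->
  is_derive (fun y => f y - g y) x (df - dg).
Proof. intros Hf Hg; exact (is_derive_minus f g x df dg Hf Hg). Qed.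

Lemma Cn_near_mult (n : nat) (r : R) (w v : R -> R -> R -> R) :
  Cn_near n r w -> Cn_near n r v ->
  Cn_near n r (fun t s x => w t s x * v t s x).
Proof.
  revert w v; induction n as [| n IH]; intros w v Hw Hv.
  all: assert (Hc : forall t s x, Rabs t < r -> Rabs s < r ->
      continuous3 (fun t s x => w t s x * v t s x) t s x)
    by (intros t s x Ht Hs;
        exact (continuous_mult (K := R_AbsRing) _ _ _
          (Cn_near_continuous _ _ _ t s x Hw Ht Hs)
          (Cn_near_continuous _ _ _ t s x Hv Ht Hs))).
  - split; [exact Hc | exact I].
  - pose proof (Cn_near_le _ _ _ Hw) as Hw0.
    pose proof (Cn_near_le _ _ _ Hv) as Hv0.
    destruct (Cn_near_S_elim _ _ _ Hw) as (Dw & Hw1 & Hw2 & Hw3).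
    destruct (Cn_near_S_elim _ _ _ Hv) as (Dv & Hv1 & Hv2 & Hv3).
    apply Cn_near_S_intro
      with (fun t s x => Dt w t s x * v t s x + w t s x * Dt v t s x)
        (fun t s x => Ds w t s x * v t s x + w t s x * Ds v t s x)
        (fun t s x => Dx w t s x * v t s x + w t s x * Dx v t s x);
      try (apply Cn_near_plus; apply IH; assumption); [exact Hc |].
    intros t s x Ht Hs.
    destruct (Dw t s x Ht Hs) as (A1 & A2 & A3).
    destruct (Dv t s x Ht Hs) as (B1 & B2 & B3).
    split; [| split].
    + apply (is_derive_Rmult (fun tau => w tau s x) (fun tau => v tau s x)); assumption.
    + apply (is_derive_Rmult (fun sigma => w t sigma x) (fun sigma => v t sigma x));
        assumption.
    + apply is_derive_Rmult; assumption.
Qed.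

(** The partials of [/ w] are those of [w] times [- / w * / w]. Hence, unlike for sums and products,
    the induction on the order can keep [w] fixed. *)
Lemma Cn_near_inv (n : nat) (r : R) (w : R -> R -> R -> R) :
  (forall t s x, Rabs t < r -> Rabs s < r -> w t s x <> 0) ->
  Cn_near n r w -> Cn_near n r (fun t s x => / w t s x).
Proof.
  intros Hnz; induction n as [| n IH]; intros Hw.
  all: assert (Hc : forall t s x, Rabs t < r -> Rabs s < r ->
      continuous3 (fun t s x => / w t s x) t s x)
    by (intros t s x Ht Hs;
        apply (continuous_comp
          (fun p : R * R * R => w (fst (fst p)) (snd (fst p)) (snd p)) Rinv);
        [ exact (Cn_near_continuous _ _ _ t s x Hw Ht Hs)
        | apply (continuous_Rinv_comp (fun y => y));
          [apply continuous_id | apply Hnz; assumption] ]).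
  - split; [exact Hc | exact I].
  - pose proof (IH (Cn_near_le _ _ _ Hw)) as Hi.
    destruct (Cn_near_S_elim _ _ _ Hw) as (Dw & Hw1 & Hw2 & Hw3).
    assert (Hd : forall z, Cn_near n r z ->
      Cn_near n r (fun t s x => - z t s x / w t s x ^ 2)).
    { intros z Hz.
      apply Cn_near_ext
        with (fun t s x => -1 * z t s x * (/ w t s x * / w t s x)).
      - intros t s x Ht Hs; field; apply Hnz; assumption.
      - repeat apply Cn_near_mult; auto using Cn_near_const. }
    apply Cn_near_S_intro with (fun t s x => - Dt w t s x / w t s x ^ 2)
      (fun t s x => - Ds w t s x / w t s x ^ 2)
      (fun t s x => - Dx w t s x / w t s x ^ 2); auto.
    intros t s x Ht Hs.
    destruct (Dw t s x Ht Hs) as (A1 & A2 & A3).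
    split; [| split].
    + apply (is_derive_inv (fun tau => w tau s x)); auto.
    + apply (is_derive_inv (fun sigma => w t sigma x)); auto.
    + apply is_derive_inv; auto.
Qed.

(** * Integrals depending on parameters *)

Lemma RInt_ext_R (f g : R -> R) (a b : R) :
  (forall x, f x = g x) -> RInt f a b = RInt g a b.
Proof. intros H; apply RInt_ext; auto. Qed.

Lemma RInt_minus_R (f g : R -> R) (a b : R) :
  ex_RInt f a b -> ex_RInt g a b ->
  RInt (fun x => f x - g x) a b = RInt f a b - RInt g a b.
Proof. intros Hf Hg; exact (RInt_minus f g a b Hf Hg). Qed.

Lemma RInt_scal_R (f : R -> R) (c a b : R) :
  ex_RInt f a b -> RInt (fun x => c * f x) a b = c * RInt f a b.
Proof. intros Hf; exact (RInt_scal f a b c Hf). Qed.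

Lemma RInt_plus_R (f g : R -> R) (a b : R) :
  ex_RInt f a b -> ex_RInt g a b ->
  RInt (fun x => f x + g x) a b = RInt f a b + RInt g a b.
Proof. intros Hf Hg; exact (RInt_plus f g a b Hf Hg). Qed.

Lemma ex_RInt_everywhere (f : R -> R) (a b : R) :
  (forall x, continuous f x) -> ex_RInt f a b.
Proof. intros Hf; apply (ex_RInt_continuous (V := R_CompleteNormedModule)); auto. Qed.

Lemma is_derive_primitive (f : R -> R) (x : R) :
  (forall y, continuous f y) -> is_derive (RInt f 0) x (f x).
Proof.
  intros Hf.
  apply (is_derive_RInt f (RInt f 0) 0); [| apply Hf].
  apply filter_forall; intros b.
  apply (RInt_correct (V := R_CompleteNormedModule)), ex_RInt_everywhere, Hf.
Qed.

Lemma Rabs_RInt_0_le (f : R -> R) (x m : R) :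
  (forall y, continuous f y) -> (forall y, Rabs y <= Rabs x -> Rabs (f y) <= m) ->
  Rabs (RInt f 0 x) <= Rabs x * m.
Proof.
  intros Hf Hm.
  destruct (Rle_dec 0 x) as [Hx | Hx].
  - rewrite (Rabs_pos_eq x Hx).
    replace x with (x - 0) at 2 by ring.
    apply abs_RInt_le_const; [exact Hx | apply ex_RInt_everywhere, Hf |].
    intros y Hy; apply Hm; rewrite !Rabs_pos_eq; lra.
  - rewrite <- opp_RInt_swap by (apply ex_RInt_everywhere, Hf).
    change (Rabs (- RInt f x 0) <= Rabs x * m).
    rewrite Rabs_Ropp, (Rabs_left x) by lra.
    replace (- x) with (0 - x) by ring.
    apply abs_RInt_le_const; [lra | apply ex_RInt_everywhere, Hf |].
    intros y Hy; apply Hm; rewrite !Rabs_left1; lra.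
Qed.

Lemma continuous3_RInt (r : R) (w : R -> R -> R -> R) (t s x : R) :
  (forall t s x, Rabs t < r -> Rabs s < r -> continuous3 w t s x) ->
  Rabs t < r -> Rabs s < r -> continuous3 (fun t s x => RInt (w t s) 0 x) t s x.
Proof.
  intros Hw Ht Hs.
  assert (Hc : forall t s x, Rabs t < r -> Rabs s < r -> continuous (w t s) x).
  { intros; apply continuous3_continuous, Hw; assumption. }
  apply continuous3_eps; intros eps.
  (* Every upper limit within distance 1 of [x] lies in [[- m, m]]. On this interval the integrand
     may move by [eps / (2 * m)], which costs at most [eps / 2] in the integral. *)
  set (m := Rabs x + 1).
  assert (Hm : 0 < m) by (pose proof (Rabs_pos x); unfold m; lra).
  assert (Heps : 0 < eps / (2 * m)).
  { apply Rdiv_lt_0_compat; [apply cond_pos | lra]. }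
  destruct (continuous3_tube w t s (- m) m (fun y _ => Hw t s y Ht Hs)
    (mkposreal _ Heps)) as [d1 Hd1].
  assert (Hp : continuous (RInt (w t s) 0) x).
  { apply (ex_derive_continuous (RInt (w t s) 0)).
    eexists; apply is_derive_primitive; intros; apply Hc; assumption. }
  destruct (proj1 (filterlim_locally _ _) Hp (pos_div_2 eps)) as [d2 Hd2].
  destruct (Rabs_lt_locally r t Ht) as [d3 Hd3].
  destruct (Rabs_lt_locally r s Hs) as [d4 Hd4].
  assert (Hd : 0 < Rmin 1 (Rmin (Rmin d1 d2) (Rmin d3 d4))).
  { repeat apply Rmin_pos; try apply cond_pos; lra. }
  exists (mkposreal _ Hd); intros t' s' y Ht' Hs' Hy; simpl in Ht', Hs', Hy.
  apply Rmin_Rgt in Ht' as [_ Ht']; apply Rmin_Rgt in Ht' as [Ht1 Ht3].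
  apply Rmin_Rgt in Ht1 as [Ht1 _]; apply Rmin_Rgt in Ht3 as [Ht3 _].
  apply Rmin_Rgt in Hs' as [_ Hs']; apply Rmin_Rgt in Hs' as [Hs1 Hs4].
  apply Rmin_Rgt in Hs1 as [Hs1 _]; apply Rmin_Rgt in Hs4 as [_ Hs4].
  apply Rmin_Rgt in Hy as [Hy1 Hy2]; apply Rmin_Rgt in Hy2 as [Hy2 _].
  apply Rmin_Rgt in Hy2 as [_ Hy2].
  pose proof (Hd3 t' Ht3) as Htr; pose proof (Hd4 s' Hs4) as Hsr.
  assert (Hym : Rabs y <= m).
  { replace y with (x + (y - x)) by ring.
    eapply Rle_trans; [apply Rabs_triang | unfold m; lra]. }
  (* The change of parameters is separated from the change of the upper limit. *)
  replace (RInt (w t' s') 0 y - RInt (w t s) 0 x)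
    with (RInt (fun z => w t' s' z - w t s z) 0 y
          + (RInt (w t s) 0 y - RInt (w t s) 0 x))
    by (rewrite RInt_minus_R by (apply ex_RInt_everywhere; intros; apply Hc; assumption);
        ring).
  assert (H1 : Rabs (RInt (fun z => w t' s' z - w t s z) 0 y)
                 <= Rabs y * (eps / (2 * m))).
  { apply Rabs_RInt_0_le.
    - intros z; apply @continuous_minus; apply Hc; assumption.
    - intros z Hz; apply Rlt_le, (Hd1 t' s' z Ht1 Hs1).
      apply Rabs_le_between; lra. }
  assert (H2 : Rabs y * (eps / (2 * m)) <= eps / 2).
  { replace (eps / 2) with (m * (eps / (2 * m))) by (field; lra).
    apply Rmult_le_compat_r; lra. }
  pose proof (Hd2 y Hy2 : Rabs (RInt (w t s) 0 y - RInt (w t s) 0 x) < eps / 2).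
  eapply Rle_lt_trans; [apply Rabs_triang | lra].
Qed.

Lemma is_derive_t_RInt (r : R) (w : R -> R -> R -> R) (a b t s : R) :
  Cn_near 1 r w -> Rabs t < r -> Rabs s < r ->
  is_derive (fun tau => RInt (w tau s) a b) t (RInt (Dt w t s) a b).
Proof.
  intros Hw Ht Hs.
  destruct (Cn_near_S_elim _ _ _ Hw) as (Hd & Hw1 & _).
  apply (is_derive_RInt_param (fun tau x => w tau s x)).
  - apply (filter_imp (fun tau => Rabs tau < r)); [| apply Rabs_lt_locally, Ht].
    intros tau Htau x _; exact (ex_intro _ _ (proj1 (Hd tau s x Htau Hs))).
  - intros x _ eps.
    destruct (proj1 (continuous3_eps _ _ _ _)
      (Cn_near_continuous _ _ _ t s x Hw1 Ht Hs) eps) as [d Hd'].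
    exists d; intros tau y Htau Hy; apply Hd'; [exact Htau | | exact Hy].
    rewrite Rminus_diag, Rabs_R0; apply cond_pos.
  - apply (filter_imp (fun tau => Rabs tau < r)); [| apply Rabs_lt_locally, Ht].
    intros tau Htau; apply ex_RInt_everywhere; intros x.
    apply (continuous3_continuous w), (Cn_near_continuous 1 r); assumption.
Qed.

Lemma is_derive_s_RInt (r : R) (w : R -> R -> R -> R) (a b t s : R) :
  Cn_near 1 r w -> Rabs t < r -> Rabs s < r ->
  is_derive (fun sigma => RInt (w t sigma) a b) s (RInt (Ds w t s) a b).
Proof.
  intros Hw Ht Hs.
  destruct (Cn_near_S_elim _ _ _ Hw) as (Hd & _ & Hw2 & _).
  apply (is_derive_RInt_param (fun sigma x => w t sigma x)).
  - apply (filter_imp (fun sigma => Rabs sigma < r)); [| apply Rabs_lt_locally, Hs].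
    intros sigma Hsigma x _.
    exact (ex_intro _ _ (proj1 (proj2 (Hd t sigma x Ht Hsigma)))).
  - intros x _ eps.
    destruct (proj1 (continuous3_eps _ _ _ _)
      (Cn_near_continuous _ _ _ t s x Hw2 Ht Hs) eps) as [d Hd'].
    exists d; intros sigma y Hsigma Hy; apply Hd'; [| exact Hsigma | exact Hy].
    rewrite Rminus_diag, Rabs_R0; apply cond_pos.
  - apply (filter_imp (fun sigma => Rabs sigma < r)); [| apply Rabs_lt_locally, Hs].
    intros sigma Hsigma; apply ex_RInt_everywhere; intros x.
    apply (continuous3_continuous w), (Cn_near_continuous 1 r); assumption.
Qed.

Lemma smooth_near_partials (r : R) (w : R -> R -> R -> R) :
  smooth_near r w ->
  (forall t s x, Rabs t < r -> Rabs s < r ->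
     is_derive (fun tau => w tau s x) t (Dt w t s x) /\
     is_derive (fun sigma => w t sigma x) s (Ds w t s x) /\
     is_derive (w t s) x (Dx w t s x)) /\
  smooth_near r (Dt w) /\ smooth_near r (Ds w) /\ smooth_near r (Dx w).
Proof.
  intros Hw.
  split; [apply (Cn_near_S_elim 0), Hw |].
  split; [| split]; intros n; apply (Cn_near_S_elim n), Hw.
Qed.

Lemma smooth_near_is_derive_t (r : R) (w : R -> R -> R -> R) (t s x : R) :
  smooth_near r w -> Rabs t < r -> Rabs s < r ->
  is_derive (fun tau => w tau s x) t (Dt w t s x).
Proof.
  intros Hw Ht Hs.
  exact (proj1 (proj1 (smooth_near_partials r w Hw) t s x Ht Hs)).
Qed.

Lemma smooth_near_is_derive_s (r : R) (w : R -> R -> R -> R) (t s x : R) :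
  smooth_near r w -> Rabs t < r -> Rabs s < r ->
  is_derive (fun sigma => w t sigma x) s (Ds w t s x).
Proof.
  intros Hw Ht Hs.
  exact (proj1 (proj2 (proj1 (smooth_near_partials r w Hw) t s x Ht Hs))).
Qed.

Lemma smooth_near_is_derive_x (r : R) (w : R -> R -> R -> R) (t s x : R) :
  smooth_near r w -> Rabs t < r -> Rabs s < r ->
  is_derive (w t s) x (Dx w t s x).
Proof.
  intros Hw Ht Hs.
  exact (proj2 (proj2 (proj1 (smooth_near_partials r w Hw) t s x Ht Hs))).
Qed.

Lemma smooth_near_Dx_Dx (r : R) (w : R -> R -> R -> R) :
  smooth_near r w -> smooth_near r (Dx (Dx w)).
Proof.
  intros Hw.
  destruct (smooth_near_partials r w Hw) as (_ & _ & _ & Hx).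
  apply (smooth_near_partials r _ Hx).
Qed.

Lemma smooth_near_continuous (r : R) (w : R -> R -> R -> R) (t s x : R) :
  smooth_near r w -> Rabs t < r -> Rabs s < r -> continuous (w t s) x.
Proof.
  intros Hw Ht Hs; apply continuous3_continuous.
  exact (Cn_near_continuous 0 r w t s x (Hw 0%nat) Ht Hs).
Qed.

(** The partials are again integrals of this type, of [Dt w] and [Ds w], together with [w] itself.
    The induction on the order therefore runs over all smooth [w] at once. *)
Lemma smooth_near_RInt (r : R) (w : R -> R -> R -> R) :
  smooth_near r w -> smooth_near r (fun t s x => RInt (w t s) 0 x).
Proof.
  intros Hw n; revert w Hw.
  induction n as [| n IH]; intros w Hw.
  all: assert (Hc : forall t s x, Rabs t < r -> Rabs s < r ->
      continuous3 (fun t s x => RInt (w t s) 0 x) t s x)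
    by (intros t s x Ht Hs; apply continuous3_RInt with r; [| assumption ..];
        intros; apply (Cn_near_continuous 0 r); auto).
  - split; [exact Hc | exact I].
  - destruct (smooth_near_partials r w Hw) as (_ & H1 & H2 & _).
    apply Cn_near_S_intro with (fun t s x => RInt (Dt w t s) 0 x)
      (fun t s x => RInt (Ds w t s) 0 x) w; auto.
    intros t s x Ht Hs.
    split; [| split].
    + apply is_derive_t_RInt with r; auto.
    + apply is_derive_s_RInt with r; auto.
    + apply is_derive_primitive; intros y.
      apply smooth_near_continuous with r; assumption.
Qed.

Lemma smooth_near_RInt_01 (r : R) (w : R -> R -> R -> R) :
  smooth_near r w -> smooth_near r (fun t s _ => RInt (w t s) 0 1).
Proof.
  intros Hw n; revert w Hw.
  induction n as [| n IH]; intros w Hw.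
  all: assert (Hc : forall t s x, Rabs t < r -> Rabs s < r ->
      continuous3 (fun t s _ => RInt (w t s) 0 1) t s x)
    by (intros t s x Ht Hs; apply continuous3_eps; intros eps;
        destruct (proj1 (continuous3_eps _ _ _ _)
          (Cn_near_continuous 0 r _ t s 1 (smooth_near_RInt r w Hw 0%nat) Ht Hs)
          eps) as [d Hd];
        exists d; intros t' s' y Ht' Hs' _; apply Hd; auto;
        rewrite Rminus_diag, Rabs_R0; apply cond_pos).
  - split; [exact Hc | exact I].
  - destruct (smooth_near_partials r w Hw) as (_ & H1 & H2 & _).
    apply Cn_near_S_intro with (fun t s _ => RInt (Dt w t s) 0 1)
      (fun t s _ => RInt (Ds w t s) 0 1) (fun _ _ _ => 0); auto using Cn_near_const.
    intros t s x Ht Hs.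
    split; [| split].
    + apply is_derive_t_RInt with r; auto.
    + apply is_derive_s_RInt with r; auto.
    + apply @is_derive_const.
Qed.

(** The point is the constant subtracted by [Q]: it varies with the parameters, and its denominator
    stays positive because [w] does. *)
Lemma smooth_near_Q (r : R) (w f : R -> R -> R -> R) :
  (forall t s x, Rabs t < r -> Rabs s < r -> 0 < w t s x) ->
  smooth_near r w -> smooth_near r f ->
  smooth_near r (fun t s x => Q (w t s) (f t s) x).
Proof.
  intros Hpos Hw Hf.
  assert (Hi : smooth_near r (fun t s x => / w t s x)).
  { intros n; apply Cn_near_inv; [| apply Hw].
    intros t s x Ht Hs; apply Rgt_not_eq, Hpos; assumption. }
  assert (HF := smooth_near_RInt r f Hf).
  assert (Hint : forall t s, Rabs t < r -> Rabs s < r ->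
    0 < RInt (fun x => / w t s x) 0 1).
  { intros t s Ht Hs; apply RInt_gt_0; [lra | |].
    - intros x _; apply Rinv_0_lt_compat, Hpos; assumption.
    - intros x _; exact (smooth_near_continuous r _ t s x Hi Ht Hs). }
  intros n.
  apply Cn_near_ext with (fun t s x => RInt (f t s) 0 x
    + -1 * (RInt (fun y => / w t s y * RInt (f t s) 0 y) 0 1
            * / RInt (fun y => / w t s y) 0 1)).
  - intros t s x _ _; unfold Q, Defs.primitive; ring.
  - apply Cn_near_plus; [apply HF |].
    apply Cn_near_mult; [apply Cn_near_const |].
    apply Cn_near_mult.
    + apply (smooth_near_RInt_01 r (fun t s y => / w t s y * RInt (f t s) 0 y)).
      intros m; apply Cn_near_mult; auto.
    + apply (Cn_near_inv n r (fun t s _ => RInt (fun y => / w t s y) 0 1)).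
      * intros t s x Ht Hs; apply Rgt_not_eq, Hint; assumption.
      * exact (smooth_near_RInt_01 r _ Hi n).
Qed.

Lemma smooth_near_swap (r : R) (w : R -> R -> R -> R) (t s x : R) :
  smooth_near r w -> Rabs t < r -> Rabs s < r ->
  Ds (Dt w) t s x = Dt (Ds w) t s x /\
  Dx (Dt w) t s x = Dt (Dx w) t s x /\
  Dx (Ds w) t s x = Ds (Dx w) t s x.
Proof.
  intros Hw Ht Hs.
  destruct (smooth_near_partials r w Hw) as (D & Ht1 & Hs1 & Hx1).
  destruct (smooth_near_partials r _ Ht1) as (Dt1 & _ & Hts & Htx).
  destruct (smooth_near_partials r _ Hs1) as (Ds1 & Hst & _ & Hsx).
  destruct (smooth_near_partials r _ Hx1) as (Dx1 & Hxt & Hxs & _).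
  destruct (Rabs_lt_locally r t Ht) as [dt Hdt].
  destruct (Rabs_lt_locally r s Hs) as [ds Hds].
  (* Schwarz is a statement about two variables. Joint continuity in three variables is restricted
     to each coordinate plane, with the order of arguments in which it is applied below. *)
  assert (C2 : forall v, smooth_near r v ->
    continuity_2d_pt (fun a b => v a b x) t s /\
    continuity_2d_pt (fun a b => v b s a) x t /\
    continuity_2d_pt (fun a b => v t b a) x s).
  { intros v Hv.
    pose proof (proj1 (continuous3_eps v t s x)
      (Cn_near_continuous 0 r v t s x (Hv 0%nat) Ht Hs)) as Hc.
    split; [| split]; intros eps; destruct (Hc eps) as [d Hd];
      exists d; intros a b Ha Hb; apply Hd; auto;
      rewrite Rminus_diag, Rabs_R0; apply cond_pos. }
  split; [| split].
  - symmetry; apply (Schwarz (fun a b => w a b x));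
      [| exact (proj1 (C2 _ Hst)) | exact (proj1 (C2 _ Hts))].
    exists (mkposreal _ (Rmin_stable_in_posreal dt ds)); intros a b Ha Hb.
    assert (Ha' : Rabs a < r)
      by (apply Hdt; eapply Rlt_le_trans; [exact Ha | apply Rmin_l]).
    assert (Hb' : Rabs b < r)
      by (apply Hds; eapply Rlt_le_trans; [exact Hb | apply Rmin_r]).
    split; [| split; [| split]].
    + exact (ex_intro _ _ (proj1 (D a b x Ha' Hb'))).
    + exact (ex_intro _ _ (proj1 (proj2 (D a b x Ha' Hb')))).
    + exact (ex_intro _ _ (proj1 (Ds1 a b x Ha' Hb'))).
    + exact (ex_intro _ _ (proj1 (proj2 (Dt1 a b x Ha' Hb')))).
  - apply (Schwarz (fun a b => w b s a));
      [| exact (proj1 (proj2 (C2 _ Htx))) | exact (proj1 (proj2 (C2 _ Hxt)))].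
    exists dt; intros a b Ha Hb.
    pose proof (Hdt b Hb) as Hb'.
    split; [| split; [| split]].
    + exact (ex_intro _ _ (proj2 (proj2 (D b s a Hb' Hs)))).
    + exact (ex_intro _ _ (proj1 (D b s a Hb' Hs))).
    + exact (ex_intro _ _ (proj2 (proj2 (Dt1 b s a Hb' Hs)))).
    + exact (ex_intro _ _ (proj1 (Dx1 b s a Hb' Hs))).
  - apply (Schwarz (fun a b => w t b a));
      [| exact (proj2 (proj2 (C2 _ Hsx))) | exact (proj2 (proj2 (C2 _ Hxs)))].
    exists ds; intros a b Ha Hb.
    pose proof (Hds b Hb) as Hb'.
    split; [| split; [| split]].
    + exact (ex_intro _ _ (proj2 (proj2 (D t b a Ht Hb')))).
    + exact (ex_intro _ _ (proj1 (proj2 (D t b a Ht Hb')))).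
    + exact (ex_intro _ _ (proj2 (proj2 (Ds1 t b a Ht Hb')))).
    + exact (ex_intro _ _ (proj1 (proj2 (Dx1 t b a Ht Hb')))).
Qed.

(** * The operator [Q] *)

Lemma RInt_derive (F dF : R -> R) (a b : R) :
  (forall x, is_derive F x (dF x)) -> (forall x, continuous dF x) ->
  RInt dF a b = F b - F a.
Proof.
  intros HF HdF.
  apply is_RInt_unique, (is_RInt_derive F dF); auto.
Qed.

Lemma continuous_Rmult (f g : R -> R) (x : R) :
  continuous f x -> continuous g x -> continuous (fun y => f y * g y) x.
Proof. exact (continuous_mult (K := R_AbsRing) f g x). Qed.

Lemma continuous_Rplus (f g : R -> R) (x : R) :
  continuous f x -> continuous g x -> continuous (fun y => f y + g y) x.
Proof. exact (continuous_plus f g x). Qed.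

Lemma continuous_Rminus (f g : R -> R) (x : R) :
  continuous f x -> continuous g x -> continuous (fun y => f y - g y) x.
Proof. exact (continuous_minus f g x). Qed.

Ltac solve_continuous :=
  match goal with
  | |- continuous (fun y => @?a y * @?b y) ?x =>
      apply (continuous_Rmult a b x); solve_continuous
  | |- continuous (fun y => @?a y + @?b y) ?x =>
      apply (continuous_Rplus a b x); solve_continuous
  | |- continuous (fun y => @?a y - @?b y) ?x =>
      apply (continuous_Rminus a b x); solve_continuous
  | H : forall y, continuous ?f y |- continuous ?f ?x => exact (H x)
  | |- continuous (fun _ => ?c) ?x => apply (continuous_const c x)
  end.

Lemma is_derive_continuous (f : R -> R) (x l : R) :
  is_derive f x l -> continuous f x.
Proof. intros H; apply (ex_derive_continuous f); exists l; exact H. Qed.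

Lemma RInt_inv_pos (u : R -> R) :
  (forall x, continuous u x) -> (forall x, 0 < u x) ->
  0 < RInt (fun x => / u x) 0 1.
Proof.
  intros Hc Hpos; apply RInt_gt_0; [lra | |]; intros x _.
  - apply Rinv_0_lt_compat, Hpos.
  - apply (continuous_Rinv_comp u); [apply Hc | apply Rgt_not_eq, Hpos].
Qed.

Lemma is_derive_Q (u f : R -> R) (x : R) :
  (forall y, continuous f y) -> is_derive (Q u f) x (f x).
Proof.
  intros Hf.
  replace (f x) with (f x - 0) by ring.
  apply @is_derive_minus; [apply is_derive_primitive, Hf | apply @is_derive_const].
Qed.

(** Any primitive may replace the one based at [0]: the two differ by [F 0], and [Q] removes
    constants. This is how all later values of [Q] are computed. *)
Lemma Q_derivative (u F dF : R -> R) (x : R) :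
  (forall y, continuous u y) -> (forall y, 0 < u y) ->
  (forall y, is_derive F y (dF y)) -> (forall y, continuous dF y) ->
  Q u dF x = F x - RInt (fun y => / u y * F y) 0 1 * / RInt (fun y => / u y) 0 1.
Proof.
  intros Hu Hpos HF HdF.
  pose proof (RInt_inv_pos u Hu Hpos) as HI.
  assert (Hi : forall y, continuous (fun z => / u z) y).
  { intros y; apply (continuous_Rinv_comp u); [apply Hu | apply Rgt_not_eq, Hpos]. }
  unfold Q, Defs.primitive.
  rewrite (RInt_derive F dF) by assumption.
  rewrite (RInt_ext_R _ (fun y => / u y * F y - F 0 * / u y))
    by (intros y; rewrite (RInt_derive F dF) by assumption; ring).
  rewrite RInt_minus_R, RInt_scal_R.
  - field; lra.
  - apply ex_RInt_everywhere, Hi.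
  - apply ex_RInt_everywhere; intros y; apply continuous_Rmult;
      [apply Hi | exact (is_derive_continuous _ _ _ (HF y))].
  - apply ex_RInt_everywhere; intros y; apply continuous_Rmult;
      [apply continuous_const | apply Hi].
Qed.

(** Since [Q u f] is itself a primitive of [f], [Q_derivative] says that [Q u f] equals itself minus
    its weighted mean, so that mean is zero. *)
Lemma RInt_inv_Q (u f : R -> R) :
  (forall x, continuous u x) -> (forall x, 0 < u x) -> (forall x, continuous f x) ->
  RInt (fun x => / u x * Q u f x) 0 1 = 0.
Proof.
  intros Hu Hpos Hf.
  pose proof (RInt_inv_pos u Hu Hpos) as HI.
  pose proof (Q_derivative u (Q u f) f 0 Hu Hpos
    (fun y => is_derive_Q u f y Hf) Hf) as H.
  assert (H0 : RInt (fun y => / u y * Q u f y) 0 1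
               * / RInt (fun y => / u y) 0 1 = 0) by lra.
  apply Rmult_integral in H0 as [H0 | H0]; [exact H0 |].
  apply Rinv_neq_0_compat in H0; [contradiction | lra].
Qed.

(** Here zero mean enters the curvature computation: it closes [Q u f] up on the circle, so boundary
    terms cancel in integrations by parts. *)
Lemma Q_0_1 (u f : R -> R) : RInt f 0 1 = 0 -> Q u f 0 = Q u f 1.
Proof.
  intros Hf; unfold Q, Defs.primitive.
  rewrite Hf, (RInt_point (V := R_CompleteNormedModule)); reflexivity.
Qed.

Lemma is_derive_U (u f g : R -> R) (x : R) :
  ex_derive u x -> 0 < u x ->
  (forall y, continuous f y) -> (forall y, continuous g y) ->
  is_derive (fun y => Q u f y * Q u g y * / u y) x (U u f g x).
Proof.
  intros Hu Hpos Hf Hg.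
  replace (U u f g x)
    with ((f x * Q u g x + Q u f x * g x) * / u x
          + Q u f x * Q u g x * (- Derive u x / u x ^ 2))
    by (unfold U; field; lra).
  apply (is_derive_Rmult (fun y => Q u f y * Q u g y) (fun y => / u y)).
  - apply is_derive_Rmult; apply is_derive_Q; assumption.
  - apply is_derive_inv; [apply Derive_correct, Hu | lra].
Qed.

Lemma smooth_near_mult (r : R) (w v : R -> R -> R -> R) :
  smooth_near r w -> smooth_near r v -> smooth_near r (fun t s x => w t s x * v t s x).
Proof. intros Hw Hv n; apply Cn_near_mult; auto. Qed.

Lemma smooth_near_minus (r : R) (w v : R -> R -> R -> R) :
  smooth_near r w -> smooth_near r v -> smooth_near r (fun t s x => w t s x - v t s x).
Proof.
  intros Hw Hv n.
  apply Cn_near_ext with (fun t s x => w t s x + -1 * v t s x);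
    [intros; ring |].
  apply Cn_near_plus; [apply Hw |].
  apply Cn_near_mult; [apply Cn_near_const | apply Hv].
Qed.

Lemma smooth_near_inv (r : R) (w : R -> R -> R -> R) :
  (forall t s x, Rabs t < r -> Rabs s < r -> 0 < w t s x) ->
  smooth_near r w -> smooth_near r (fun t s x => / w t s x).
Proof.
  intros Hpos Hw n; apply Cn_near_inv; [| apply Hw].
  intros t s x Ht Hs; apply Rgt_not_eq, Hpos; assumption.
Qed.

(* Differentiates the normalisation [int w^-1 Q(f) = 0] along the family. *)
Lemma RInt_partials_inv_Q (r : R) (w f : R -> R -> R -> R) :
  0 < r ->
  (forall t s x, Rabs t < r -> Rabs s < r -> 0 < w t s x) ->
  smooth_near r w -> smooth_near r f ->
  let F := fun t s x => Q (w t s) (f t s) x in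
  RInt (fun x => / w 0 0 x * Dt F 0 0 x
                 - F 0 0 x * Dt w 0 0 x * (/ w 0 0 x * / w 0 0 x)) 0 1 = 0 /\
  RInt (fun x => / w 0 0 x * Ds F 0 0 x
                 - F 0 0 x * Ds w 0 0 x * (/ w 0 0 x * / w 0 0 x)) 0 1 = 0.
Proof.
  intros Hr Hpos Hw Hf F.
  assert (H0 : Rabs 0 < r) by (rewrite Rabs_R0; exact Hr).
  pose proof (smooth_near_Q r w f Hpos Hw Hf : smooth_near r F) as HF.
  pose proof (smooth_near_inv r w Hpos Hw) as Hi.
  pose (G := fun t s x => / w t s x * F t s x).
  assert (HG : smooth_near r G) by (apply smooth_near_mult; assumption).
  assert (HG0 : forall t s, Rabs t < r -> Rabs s < r -> RInt (G t s) 0 1 = 0).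
  { intros t s Ht Hs; apply (RInt_inv_Q (w t s) (f t s)); intros x;
      [apply smooth_near_continuous with r | apply Hpos
      | apply smooth_near_continuous with r]; assumption. }
  destruct (smooth_near_partials r w Hw) as (Dw & _).
  destruct (smooth_near_partials r F HF) as (DF & _).
  split.
  - transitivity (RInt (Dt G 0 0) 0 1).
    + apply RInt_ext_R; intros x.
      symmetry; apply is_derive_unique.
      replace (/ w 0 0 x * Dt F 0 0 x
               - F 0 0 x * Dt w 0 0 x * (/ w 0 0 x * / w 0 0 x))
        with (- Dt w 0 0 x / w 0 0 x ^ 2 * F 0 0 x + / w 0 0 x * Dt F 0 0 x)
        by (field; apply Rgt_not_eq, Hpos; assumption).
      apply (is_derive_Rmult (fun t => / w t 0 x) (fun t => F t 0 x));
        [| exact (proj1 (DF 0 0 x H0 H0))].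
      apply (is_derive_inv (fun t => w t 0 x));
        [exact (proj1 (Dw 0 0 x H0 H0)) | apply Rgt_not_eq, Hpos; assumption].
    (* By differentiation under the integral sign this is the derivative of a function of [t] that
       vanishes for all small [t]. *)
    + rewrite <- (is_derive_unique _ _ _ (is_derive_t_RInt r G 0 1 0 0 (HG 1%nat) H0 H0)).
      transitivity (Derive (fun _ : R => 0) 0); [| apply Derive_const].
      apply Derive_ext_loc.
      apply (filter_imp (fun t => Rabs t < r)); [| apply Rabs_lt_locally, H0].
      intros t Ht; apply HG0; assumption.
  - transitivity (RInt (Ds G 0 0) 0 1).
    + apply RInt_ext_R; intros x.
      symmetry; apply is_derive_unique.
      replace (/ w 0 0 x * Ds F 0 0 x
               - F 0 0 x * Ds w 0 0 x * (/ w 0 0 x * / w 0 0 x))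
        with (- Ds w 0 0 x / w 0 0 x ^ 2 * F 0 0 x + / w 0 0 x * Ds F 0 0 x)
        by (field; apply Rgt_not_eq, Hpos; assumption).
      apply (is_derive_Rmult (fun s => / w 0 s x) (fun s => F 0 s x));
        [| exact (proj1 (proj2 (DF 0 0 x H0 H0)))].
      apply (is_derive_inv (fun s => w 0 s x));
        [exact (proj1 (proj2 (Dw 0 0 x H0 H0))) | apply Rgt_not_eq, Hpos; assumption].
    + rewrite <- (is_derive_unique _ _ _ (is_derive_s_RInt r G 0 1 0 0 (HG 1%nat) H0 H0)).
      transitivity (Derive (fun _ : R => 0) 0); [| apply Derive_const].
      apply Derive_ext_loc.
      apply (filter_imp (fun s => Rabs s < r)); [| apply Rabs_lt_locally, H0].
      intros s Hs; apply HG0; assumption.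
Qed.

(** The difference on the left is a primitive of [f - g] with weighted mean zero, so [Q_derivative]
    subtracts nothing from it. *)
Lemma Q_minus (u f g : R -> R) (x : R) :
  (forall y, continuous u y) -> (forall y, 0 < u y) ->
  (forall y, continuous f y) -> (forall y, continuous g y) ->
  Q u f x - Q u g x = Q u (fun y => f y - g y) x.
Proof.
  intros Hu Hpos Hf Hg.
  rewrite (Q_derivative u (fun y => Q u f y - Q u g y) (fun y => f y - g y) x); auto.
  - rewrite (RInt_ext_R _ (fun y => / u y * Q u f y - / u y * Q u g y))
      by (intros y; ring).
    assert (Hc : forall k, (forall y, continuous k y) ->
      ex_RInt (fun y => / u y * Q u k y) 0 1).
    { intros k Hk; apply ex_RInt_everywhere; intros y; apply continuous_Rmult.
      - apply (continuous_Rinv_comp u); [apply Hu | apply Rgt_not_eq, Hpos].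
      - apply (is_derive_continuous _ _ (k y)), is_derive_Q, Hk. }
    rewrite RInt_minus_R, !RInt_inv_Q by auto; ring.
  - intros y; apply is_derive_Rminus; apply is_derive_Q; assumption.
  - intros y; apply @continuous_minus; auto.
Qed.

Lemma Q_zero (u : R -> R) (x : R) : Q u (fun _ => 0) x = 0.
Proof.
  assert (H : forall y, RInt (fun _ : R => 0) 0 y = 0).
  { intros y; rewrite RInt_const; apply Rmult_0_r. }
  unfold Q, Defs.primitive.
  rewrite H, (RInt_ext_R _ (fun _ => 0)) by (intros y; rewrite H; apply Rmult_0_r).
  rewrite H; ring.
Qed.

(** Reduces an integral identity to a pointwise one that [ring] or [field] can check; shorter
    combinations are padded with the zero function. *)
Lemma RInt_linear3 (c1 c2 c3 : R) (f1 f2 f3 f : R -> R) :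
  (forall x, continuous f1 x) -> (forall x, continuous f2 x) ->
  (forall x, continuous f3 x) ->
  (forall x, f x = c1 * f1 x + c2 * f2 x + c3 * f3 x) ->
  RInt f 0 1 = c1 * RInt f1 0 1 + c2 * RInt f2 0 1 + c3 * RInt f3 0 1.
Proof.
  intros H1 H2 H3 E.
  assert (Hs : forall c k, (forall x, continuous k x) ->
    forall x, continuous (fun y : R => c * k y) x).
  { intros c k Hk x; apply continuous_Rmult; [apply continuous_const | apply Hk]. }
  rewrite (RInt_ext_R _ _ _ _ E), !RInt_plus_R, !RInt_scal_R;
    try reflexivity; apply ex_RInt_everywhere; auto.
  intros x; apply @continuous_plus; auto.
Qed.

(* [RInt] makes equations live in the carrier of a normed module, where [ring]
   does not recognise [R]. *)
Ltac ring_R :=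
  match goal with |- @eq _ ?a ?b => change (@eq R a b); ring end.

(* [v], [p], [q] stand for [1 / u], [P], [N]; [qt], [qs], [ps] stand for the
   derivatives of [N] and [P] along the family, which enter only through the
   differentiated normalisations. *)
Lemma projection_constants (v dv f g p q qt qs ps : R -> R) :
  (forall x, is_derive v x (dv x)) -> (forall x, continuous dv x) ->
  (forall x, is_derive p x (f x)) -> (forall x, continuous f x) ->
  (forall x, is_derive q x (g x)) -> (forall x, continuous g x) ->
  (forall x, continuous qt x) -> (forall x, continuous qs x) ->
  (forall x, continuous ps x) ->
  v 0 = v 1 -> p 0 = p 1 -> q 0 = q 1 ->
  RInt (fun x => v x * qt x - q x * f x * (v x * v x)) 0 1 = 0 ->
  RInt (fun x => v x * qs x - q x * g x * (v x * v x)) 0 1 = 0 ->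
  RInt (fun x => v x * ps x - p x * g x * (v x * v x)) 0 1 = 0 ->
  let J := RInt (fun x => (f x * q x - p x * g x) * (v x * v x)) 0 1 in
  RInt (fun x => v x * (qt x - ((f x * q x + p x * g x) * v x + p x * q x * dv x))) 0 1
    = / 2 * J /\
  RInt (fun x => v x * (qs x - ((g x * q x + q x * g x) * v x + q x * q x * dv x))) 0 1
    = 0 /\
  RInt (fun x => v x * (ps x - qt x)) 0 1 = - J /\
  RInt (fun x => v x * p x * (g x * v x + q x * dv x)) 0 1 = - / 2 * J.
Proof.
  intros Dv Cdv Dp Cf Dq Cg Cqt Cqs Cps v01 p01 q01 Hqt Hqs Hps J.
  assert (Cv : forall x, continuous v x) by (intros x; eapply is_derive_continuous, Dv).
  assert (Cp : forall x, continuous p x) by (intros x; eapply is_derive_continuous, Dp).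
  assert (Cq : forall x, continuous q x) by (intros x; eapply is_derive_continuous, Dq).
  (* The integrand is the derivative of [a * q * v ^ 2], whose values at [0] and [1] agree. *)
  assert (parts : forall a da : R -> R, (forall x, is_derive a x (da x)) ->
    (forall x, continuous da x) -> a 0 = a 1 ->
    RInt (fun x => (da x * q x + a x * g x) * (v x * v x)
                   + a x * q x * (dv x * v x + v x * dv x)) 0 1 = 0).
  { intros a da Da Cda a01.
    assert (Ca : forall x, continuous a x) by (intros x; eapply is_derive_continuous, Da).
    rewrite (RInt_derive (fun x => a x * q x * (v x * v x))).
    - rewrite v01, a01, q01; apply Rminus_diag.
    - intros x.
      apply (is_derive_Rmult (fun y => a y * q y) (fun y => v y * v y));
        apply is_derive_Rmult; auto.
    - intros x; solve_continuous. }
  pose proof (parts p f Dp Cf p01) as HM.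
  pose proof (parts q g Dq Cg q01) as HN.
  unfold J; split; [| split; [| split]].
  (* In all four identities the factors [/ 2] come from splitting [f * q] and [p * g] into symmetric
     and antisymmetric halves. The exact derivative of [p * q * v ^ 2] absorbs the symmetric half
     together with the [dv] term, and the antisymmetric half is [J]. *)
  - etransitivity; [apply (RInt_linear3 1 (- / 2) (/ 2)
      (fun x => v x * qt x - q x * f x * (v x * v x))
      (fun x => (f x * q x + p x * g x) * (v x * v x)
                + p x * q x * (dv x * v x + v x * dv x))
      (fun x => (f x * q x - p x * g x) * (v x * v x))) | rewrite Hqt, HM; ring_R].
    1-4: intros x; solve [solve_continuous | field].
  - etransitivity; [apply (RInt_linear3 1 (- / 2) 0
      (fun x => v x * qs x - q x * g x * (v x * v x))
      (fun x => (g x * q x + q x * g x) * (v x * v x)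
                + q x * q x * (dv x * v x + v x * dv x))
      (fun _ => 0)) | rewrite Hqs, HN; ring_R].
    1-4: intros x; solve [solve_continuous | field].
  - etransitivity; [apply (RInt_linear3 1 (-1) (-1)
      (fun x => v x * ps x - p x * g x * (v x * v x))
      (fun x => v x * qt x - q x * f x * (v x * v x))
      (fun x => (f x * q x - p x * g x) * (v x * v x))) | rewrite Hqt, Hps; ring_R].
    1-4: intros x; solve [solve_continuous | field].
  - etransitivity; [apply (RInt_linear3 (/ 2) (- / 2) 0
      (fun x => (f x * q x + p x * g x) * (v x * v x)
                + p x * q x * (dv x * v x + v x * dv x))
      (fun x => (f x * q x - p x * g x) * (v x * v x))
      (fun _ => 0)) | rewrite HM; ring_R].
    1-4: intros x; solve [solve_continuous | field].
Qed.

(** * The curvature in terms of coefficients *)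

(* The Levi-Civita term is an exact derivative:
   [U f g = (Q(f) Q(g) / u)']. *)
Definition flux (w f g : R -> R -> R -> R) (t s x : R) : R :=
  Q (w t s) (f t s) x * Q (w t s) (g t s) x * / w t s x.

Lemma smooth_near_flux (r : R) (w f g : R -> R -> R -> R) :
  (forall t s x, Rabs t < r -> Rabs s < r -> 0 < w t s x) ->
  smooth_near r w -> smooth_near r f -> smooth_near r g ->
  smooth_near r (flux w f g).
Proof.
  intros Hpos Hw Hf Hg.
  apply (smooth_near_mult r (fun t s x => Q (w t s) (f t s) x * Q (w t s) (g t s) x)).
  - apply smooth_near_mult; apply smooth_near_Q; assumption.
  - apply smooth_near_inv; assumption.
Qed.

Lemma Derive_U_flux (r : R) (w f g : R -> R -> R -> R) (t s x : R) :
  (forall t s x, Rabs t < r -> Rabs s < r -> 0 < w t s x) ->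
  smooth_near r w -> smooth_near r f -> smooth_near r g ->
  Rabs t < r -> Rabs s < r ->
  Derive (U (w t s) (f t s) (g t s)) x = Dx (Dx (flux w f g)) t s x.
Proof.
  intros Hpos Hw Hf Hg Ht Hs.
  apply Derive_ext; intros y; symmetry; apply is_derive_unique, is_derive_U.
  - destruct (smooth_near_partials r w Hw) as (Dw & _).
    exact (ex_intro _ _ (proj2 (proj2 (Dw t s y Ht Hs)))).
  - apply Hpos; assumption.
  - intros z; apply smooth_near_continuous with r; assumption.
  - intros z; apply smooth_near_continuous with r; assumption.
Qed.

Lemma smooth_near_swap_xx (r : R) (w : R -> R -> R -> R) (t s x : R) :
  smooth_near r w -> Rabs t < r -> Rabs s < r ->
  Dt (Dx (Dx w)) t s x = Dx (Dx (Dt w)) t s x /\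
  Ds (Dx (Dx w)) t s x = Dx (Dx (Ds w)) t s x.
Proof.
  intros Hw Ht Hs.
  destruct (smooth_near_partials r w Hw) as (_ & _ & _ & Hx).
  destruct (smooth_near_swap r _ t s x Hx Ht Hs) as (_ & E1 & E2).
  rewrite <- E1, <- E2.
  split; apply Derive_ext; intros y;
    destruct (smooth_near_swap r w t s y Hw Ht Hs) as (_ & E3 & E4);
    symmetry; assumption.
Qed.

Lemma is_derive_x_Q (r : R) (w f : R -> R -> R -> R) (t s x : R) :
  smooth_near r f -> Rabs t < r -> Rabs s < r ->
  is_derive (Q (w t s) (f t s)) x (f t s x).
Proof.
  intros Hf Ht Hs; apply is_derive_Q; intros y.
  apply smooth_near_continuous with r; assumption.
Qed.

(** The constant in [Q] does not depend on [x], so it disappears once the parameter derivative and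
    the [x] derivative are exchanged. *)
Lemma is_derive_x_partials_Q (r : R) (w f : R -> R -> R -> R) (t s x : R) :
  (forall t s x, Rabs t < r -> Rabs s < r -> 0 < w t s x) ->
  smooth_near r w -> smooth_near r f -> Rabs t < r -> Rabs s < r ->
  let F := fun t s x => Q (w t s) (f t s) x in
  is_derive (Dt F t s) x (Dt f t s x) /\ is_derive (Ds F t s) x (Ds f t s x).
Proof.
  intros Hpos Hw Hf Ht Hs F.
  pose proof (smooth_near_Q r w f Hpos Hw Hf : smooth_near r F) as HF.
  destruct (smooth_near_partials r F HF) as (_ & HFt & HFs & _).
  destruct (smooth_near_swap r F t s x HF Ht Hs) as (_ & E1 & E2).
  split.
  - replace (Dt f t s x) with (Dx (Dt F) t s x).
    { exact (smooth_near_is_derive_x r _ t s x HFt Ht Hs). }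
    rewrite E1; apply Derive_ext_loc.
    apply (filter_imp (fun tau => Rabs tau < r)); [| apply Rabs_lt_locally, Ht].
    intros tau Htau; apply is_derive_unique, (is_derive_x_Q r); assumption.
  - replace (Ds f t s x) with (Dx (Ds F) t s x).
    { exact (smooth_near_is_derive_x r _ t s x HFs Ht Hs). }
    rewrite E2; apply Derive_ext_loc.
    apply (filter_imp (fun sigma => Rabs sigma < r)); [| apply Rabs_lt_locally, Hs].
    intros sigma Hsigma; apply is_derive_unique, (is_derive_x_Q r); assumption.
Qed.

Lemma is_derive_flux (p q v : R -> R) (x dp dq dv : R) :
  is_derive p x dp -> is_derive q x dq -> is_derive v x dv ->
  is_derive (fun y => p y * q y * v y) x
    ((dp * q x + dq * p x) * v x + p x * q x * dv).
Proof.
  intros Hp Hq Hv.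
  replace (dp * q x + dq * p x) with (dp * q x + p x * dq) by ring.
  apply (is_derive_Rmult (fun y => p y * q y) v); [| exact Hv].
  apply is_derive_Rmult; assumption.
Qed.

Lemma Dx_Dx_linear (r : R) (a b c d : R -> R -> R -> R) (t s x : R) :
  smooth_near r a -> smooth_near r b -> smooth_near r c -> smooth_near r d ->
  Rabs t < r -> Rabs s < r ->
  Dx (Dx (fun t s x => (a t s x + b t s x) - (c t s x + d t s x))) t s x
  = (Dx (Dx a) t s x + Dx (Dx b) t s x) - (Dx (Dx c) t s x + Dx (Dx d) t s x).
Proof.
  intros Ha Hb Hc Hd Ht Hs.
  destruct (smooth_near_partials r a Ha) as (Da & _ & _ & Ha').
  destruct (smooth_near_partials r b Hb) as (Db & _ & _ & Hb').
  destruct (smooth_near_partials r c Hc) as (Dc & _ & _ & Hc').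
  destruct (smooth_near_partials r d Hd) as (Dd & _ & _ & Hd').
  destruct (smooth_near_partials r _ Ha') as (Da' & _).
  destruct (smooth_near_partials r _ Hb') as (Db' & _).
  destruct (smooth_near_partials r _ Hc') as (Dc' & _).
  destruct (smooth_near_partials r _ Hd') as (Dd' & _).
  assert (lin : forall (f1 f2 f3 f4 : R -> R) y l1 l2 l3 l4,
    is_derive f1 y l1 -> is_derive f2 y l2 -> is_derive f3 y l3 -> is_derive f4 y l4 ->
    is_derive (fun z => (f1 z + f2 z) - (f3 z + f4 z)) y ((l1 + l2) - (l3 + l4))).
  { intros; apply @is_derive_minus; apply @is_derive_plus; assumption. }
  transitivity (Derive (fun y => (Dx a t s y + Dx b t s y) - (Dx c t s y + Dx d t s y)) x).
  - apply Derive_ext; intros y; apply is_derive_unique, lin;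
      [apply Da | apply Db | apply Dc | apply Dd]; assumption.
  - apply is_derive_unique, lin;
      [apply Da' | apply Db' | apply Dc' | apply Dd']; assumption.
Qed.

(** Here [h] and [k] are the coefficients of [D_t Y] and [D_s Y], and [A1] and [A2] those of the two
    iterated derivatives. The connection term carries a minus sign because a tangent form has
    coefficient minus [f]. Equality of [w 0 0] at [0] and [1] is all that is kept of periodicity. *)
Lemma curvature_of_coefficients (r : R) (w : R -> R -> R -> R) :
  0 < r ->
  (forall t s x, Rabs t < r -> Rabs s < r -> 0 < w t s x) ->
  smooth_near r w ->
  w 0 0 0 = w 0 0 1 ->
  RInt (Dt w 0 0) 0 1 = 0 ->
  RInt (Ds w 0 0) 0 1 = 0 ->
  let u := w 0 0 in
  let f := Dt w 0 0 in
  let g := Ds w 0 0 in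
  let h := fun t s x =>
    Dt (Ds w) t s x - Derive (U (w t s) (Dt w t s) (Ds w t s)) x in
  let k := fun t s x =>
    Ds (Ds w) t s x - Derive (U (w t s) (Ds w t s) (Ds w t s)) x in
  let A1 := fun x => Ds h 0 0 x - Derive (U u g (h 0 0)) x in
  let A2 := fun x => Dt k 0 0 x - Derive (U u f (k 0 0)) x in
  - (RInt (fun x => / u x * Q u A1 x * Q u f x) 0 1
     - RInt (fun x => / u x * Q u A2 x * Q u f x) 0 1)
  = 3 / 4 * (RInt (fun x => (f x * Q u g x - Q u f x * g x) / (u x) ^ 2) 0 1) ^ 2
    * / RInt (fun x => / u x) 0 1.
Proof.
  intros Hr Hpos Hw Hw01 Hf0 Hg0 u f g h k A1 A2.
  assert (H0 : Rabs 0 < r) by (rewrite Rabs_R0; exact Hr).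
  destruct (smooth_near_partials r w Hw) as (_ & Hwt & Hws & _).
  destruct (smooth_near_partials r _ Hws) as (_ & Hwst & Hwss & _).
  pose (P := fun t s x => Q (w t s) (Dt w t s) x).
  pose (N := fun t s x => Q (w t s) (Ds w t s) x).
  pose (v := fun t s x => / w t s x).
  assert (HP : smooth_near r P) by (apply smooth_near_Q; assumption).
  assert (HN : smooth_near r N) by (apply smooth_near_Q; assumption).
  assert (Hv : smooth_near r v) by (apply smooth_near_inv; assumption).
  destruct (smooth_near_partials r P HP) as (_ & _ & HPs & _).
  destruct (smooth_near_partials r N HN) as (_ & HNt & HNs & _).
  destruct (smooth_near_partials r v Hv) as (Dv & _ & _ & Hvx).
  pose (m := flux w (Dt w) (Ds w)).
  pose (n := flux w (Ds w) (Ds w)).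
  assert (Hm : smooth_near r m) by (apply smooth_near_flux; assumption).
  assert (Hn : smooth_near r n) by (apply smooth_near_flux; assumption).
  destruct (smooth_near_partials r m Hm) as (_ & _ & Hms & Hmx).
  destruct (smooth_near_partials r n Hn) as (_ & Hnt & _ & Hnx).
  destruct (smooth_near_partials r _ Hmx) as (_ & _ & _ & Hmxx).
  destruct (smooth_near_partials r _ Hnx) as (_ & _ & _ & Hnxx).
  (* Rewriting the connection term as a second derivative of a flux gives the smoothness of [h],
     which is needed before [h] can enter a further flux. *)
  assert (Eh : forall t s x, Rabs t < r -> Rabs s < r ->
    Dt (Ds w) t s x - Dx (Dx m) t s x = h t s x).
  { intros t s x Ht Hs; unfold h, m.
    rewrite <- (Derive_U_flux r); auto. }
  assert (Ek : forall t s x, Rabs t < r -> Rabs s < r ->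
    Ds (Ds w) t s x - Dx (Dx n) t s x = k t s x).
  { intros t s x Ht Hs; unfold k, n.
    rewrite <- (Derive_U_flux r); auto. }
  assert (Hh : smooth_near r h).
  { intros j; apply (Cn_near_ext j r _ h Eh), smooth_near_minus; assumption. }
  assert (Hk : smooth_near r k).
  { intros j; apply (Cn_near_ext j r _ k Ek), smooth_near_minus; assumption. }
  pose (mh := flux w (Ds w) h).
  pose (nk := flux w (Dt w) k).
  assert (Hmh : smooth_near r mh) by (apply smooth_near_flux; assumption).
  assert (Hnk : smooth_near r nk) by (apply smooth_near_flux; assumption).
  (* The third derivatives of [w] cancel in [A1 - A2] by symmetry. *)
  assert (HA1 : A1 = fun x =>
    Ds (Dt (Ds w)) 0 0 x - Dx (Dx (Ds m)) 0 0 x - Dx (Dx mh) 0 0 x).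
  { apply functional_extensionality; intros x; unfold A1.
    unfold u, g; rewrite (Derive_U_flux r w (Ds w) h 0 0 x) by assumption.
    f_equal.
    rewrite <- (proj2 (smooth_near_swap_xx r m 0 0 x Hm H0 H0)).
    transitivity (Derive (fun s => Dt (Ds w) 0 s x - Dx (Dx m) 0 s x) 0).
    - apply Derive_ext_loc, (filter_imp (fun s => Rabs s < r));
        [| apply Rabs_lt_locally, H0].
      intros s Hs; symmetry; apply Eh; assumption.
    - apply is_derive_unique,
        (is_derive_Rminus (fun s => Dt (Ds w) 0 s x) (fun s => Dx (Dx m) 0 s x));
        apply (smooth_near_is_derive_s r); assumption. }
  assert (HA2 : A2 = fun x =>
    Dt (Ds (Ds w)) 0 0 x - Dx (Dx (Dt n)) 0 0 x - Dx (Dx nk) 0 0 x).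
  { apply functional_extensionality; intros x; unfold A2.
    unfold u, f; rewrite (Derive_U_flux r w (Dt w) k 0 0 x) by assumption.
    f_equal.
    rewrite <- (proj1 (smooth_near_swap_xx r n 0 0 x Hn H0 H0)).
    transitivity (Derive (fun t => Ds (Ds w) t 0 x - Dx (Dx n) t 0 x) 0).
    - apply Derive_ext_loc, (filter_imp (fun t => Rabs t < r));
        [| apply Rabs_lt_locally, H0].
      intros t Ht; symmetry; apply Ek; assumption.
    - apply is_derive_unique,
        (is_derive_Rminus (fun t => Ds (Ds w) t 0 x) (fun t => Dx (Dx n) t 0 x));
        apply (smooth_near_is_derive_t r); assumption. }
  (* The parts [Ds m] and [Dt n] come from differentiating the inner connection terms, [mh] and [nk]
     from the outer connection. *)
  pose (E := fun t s x => (Ds m t s x + mh t s x) - (Dt n t s x + nk t s x)).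
  assert (HA : forall x, A1 x - A2 x = - Dx (Dx E) 0 0 x).
  { intros x; rewrite HA1, HA2; unfold E.
    rewrite (Dx_Dx_linear r) by assumption.
    destruct (smooth_near_swap r _ 0 0 x Hws H0 H0) as (-> & _); ring. }
  assert (Cx : forall z, smooth_near r z -> forall x, continuous (z 0 0) x).
  { intros z Hz x; apply smooth_near_continuous with r; assumption. }
  assert (upos : forall x, 0 < u x) by (intros x; apply Hpos; assumption).
  assert (Cu : forall x, continuous u x) by exact (Cx w Hw).
  pose (I := RInt (fun x => / u x) 0 1).
  pose (J := RInt (fun x => (f x * N 0 0 x - P 0 0 x * g x) * (v 0 0 x * v 0 0 x)) 0 1).
  assert (HI : 0 < I) by (apply RInt_inv_pos; assumption).
  assert (Dp : forall x, is_derive (P 0 0) x (f x))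
    by (intros x; apply (is_derive_x_Q r); assumption).
  assert (Dq : forall x, is_derive (N 0 0) x (g x))
    by (intros x; apply (is_derive_x_Q r); assumption).
  assert (Dvx : forall x, is_derive (v 0 0) x (Dx v 0 0 x))
    by (intros x; apply Dv; assumption).
  destruct (RInt_partials_inv_Q r w (Dt w) Hr Hpos Hw Hwt) as (_ & IPs).
  destruct (RInt_partials_inv_Q r w (Ds w) Hr Hpos Hw Hws) as (INt & INs).
  assert (v01 : v 0 0 0 = v 0 0 1) by (unfold v; rewrite Hw01; reflexivity).
  destruct (projection_constants (v 0 0) (Dx v 0 0) f g (P 0 0) (N 0 0)
    (Dt N 0 0) (Ds N 0 0) (Ds P 0 0) Dvx (Cx _ Hvx) Dp (Cx _ Hwt) Dq (Cx _ Hws)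
    (Cx _ HNt) (Cx _ HNs) (Cx _ HPs) v01 (Q_0_1 u f Hf0) (Q_0_1 u g Hg0)
    INt INs IPs) as (K1 & K2 & K3 & K4).
  fold J in K1, K3, K4.
  (* [A1 - A2] is a multiple of [(Q(g) / u)'']. *)
  pose (Y := fun t s x => N t s x * v t s x).
  assert (HY : smooth_near r Y) by (apply smooth_near_mult; assumption).
  destruct (smooth_near_partials r Y HY) as (_ & _ & _ & HYx).
  destruct (smooth_near_partials r _ HYx) as (_ & _ & _ & HYxx).
  assert (HYI : RInt (fun x => v 0 0 x * P 0 0 x * Dx Y 0 0 x) 0 1 = - / 2 * J).
  { rewrite <- K4; apply RInt_ext_R; intros x; f_equal.
    apply is_derive_unique, is_derive_Rmult; auto. }
  assert (Em : forall x, Dx m 0 0 x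
    = (f x * N 0 0 x + P 0 0 x * g x) * v 0 0 x + P 0 0 x * N 0 0 x * Dx v 0 0 x).
  { intros x; rewrite (Rmult_comm (P 0 0 x) (g x)).
    apply is_derive_unique, (is_derive_flux (P 0 0) (N 0 0) (v 0 0)); auto. }
  assert (En : forall x, Dx n 0 0 x
    = (g x * N 0 0 x + N 0 0 x * g x) * v 0 0 x + N 0 0 x * N 0 0 x * Dx v 0 0 x).
  { intros x; rewrite (Rmult_comm (N 0 0 x) (g x)).
    apply is_derive_unique, (is_derive_flux (N 0 0) (N 0 0) (v 0 0)); auto. }
  (* A primitive of [h] in [x] is [Dt N - Dx m]; its weighted integral is [K1]. In [EK] below, [K2]
     makes the corresponding constant vanish. *)
  assert (EH : forall x, Q u (h 0 0) x = Dt N 0 0 x - Dx m 0 0 x - / 2 * J * / I).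
  { intros x.
    rewrite (Q_derivative u (fun y => Dt N 0 0 y - Dx m 0 0 y) (h 0 0)); auto.
    - rewrite <- K1; f_equal; f_equal.
      f_equal; apply functional_extensionality; intros y; rewrite Em; reflexivity.
    - intros y; rewrite <- Eh by assumption.
      apply is_derive_Rminus;
        [exact (proj1 (is_derive_x_partials_Q r w (Ds w) 0 0 y Hpos Hw Hws H0 H0))
        | exact (smooth_near_is_derive_x r _ 0 0 y Hmx H0 H0)]. }
  assert (EK : forall x, Q u (k 0 0) x = Ds N 0 0 x - Dx n 0 0 x).
  { intros x.
    rewrite (Q_derivative u (fun y => Ds N 0 0 y - Dx n 0 0 y) (k 0 0)); auto.
    - replace (RInt (fun y => / u y * (Ds N 0 0 y - Dx n 0 0 y)) 0 1) with 0; [ring |].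
      symmetry; refine (eq_trans (RInt_ext_R _ _ 0 1 _) K2).
      intros y; rewrite En; reflexivity.
    - intros y; rewrite <- Ek by assumption.
      apply is_derive_Rminus;
        [exact (proj2 (is_derive_x_partials_Q r w (Ds w) 0 0 y Hpos Hw Hws H0 H0))
        | exact (smooth_near_is_derive_x r _ 0 0 y Hnx H0 H0)]. }
  (* Both sides have [x] derivative equal to the mixed partial of [w], so [Ds P - Dt N] is a
     primitive of zero. Applying [Q] to the zero function shows that it equals its weighted mean,
     which [K3] evaluates. *)
  assert (EP : forall x, Ds P 0 0 x = Dt N 0 0 x - J * / I).
  { intros x.
    assert (HQ : Q u (fun _ => 0) x = Ds P 0 0 x - Dt N 0 0 x
      - RInt (fun y => v 0 0 y * (Ds P 0 0 y - Dt N 0 0 y)) 0 1 * / I).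
    { apply (Q_derivative u (fun y => Ds P 0 0 y - Dt N 0 0 y)); auto.
      - intros y.
        pose proof (is_derive_Rminus (Ds P 0 0) (Dt N 0 0) y _ _
          (proj2 (is_derive_x_partials_Q r w (Dt w) 0 0 y Hpos Hw Hwt H0 H0))
          (proj1 (is_derive_x_partials_Q r w (Ds w) 0 0 y Hpos Hw Hws H0 H0))) as HD.
        rewrite (proj1 (smooth_near_swap r w 0 0 y Hw H0 H0)), Rminus_diag in HD.
        exact HD.
      - intros y; apply continuous_const. }
    rewrite K3, Q_zero in HQ; lra. }
  (* [EP] contributes [J * / I] and [EH] contributes half of it, both multiplied by [- N * v];
     everything else cancels pointwise. *)
  assert (HE : forall x, E 0 0 x = - (3 / 2 * (J * / I)) * Y 0 0 x).
  { intros x.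
    assert (Dvt : is_derive (fun t => v t 0 x) 0 (- f x * (v 0 0 x * v 0 0 x))).
    { replace (- f x * (v 0 0 x * v 0 0 x)) with (- f x / w 0 0 x ^ 2)
        by (unfold v; field; apply Rgt_not_eq, upos).
      apply (is_derive_inv (fun t => w t 0 x));
        [exact (smooth_near_is_derive_t r w 0 0 x Hw H0 H0) | apply Rgt_not_eq, upos]. }
    assert (Dvs : is_derive (fun s => v 0 s x) 0 (- g x * (v 0 0 x * v 0 0 x))).
    { replace (- g x * (v 0 0 x * v 0 0 x)) with (- g x / w 0 0 x ^ 2)
        by (unfold v; field; apply Rgt_not_eq, upos).
      apply (is_derive_inv (fun s => w 0 s x));
        [exact (smooth_near_is_derive_s r w 0 0 x Hw H0 H0) | apply Rgt_not_eq, upos]. }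
    assert (Ems : Ds m 0 0 x
      = (Ds P 0 0 x * N 0 0 x + Ds N 0 0 x * P 0 0 x) * v 0 0 x
        + P 0 0 x * N 0 0 x * (- g x * (v 0 0 x * v 0 0 x))).
    { apply is_derive_unique,
        (is_derive_flux (fun s => P 0 s x) (fun s => N 0 s x) (fun s => v 0 s x));
        [exact (smooth_near_is_derive_s r P 0 0 x HP H0 H0)
        | exact (smooth_near_is_derive_s r N 0 0 x HN H0 H0) | exact Dvs]. }
    assert (Ent : Dt n 0 0 x
      = (Dt N 0 0 x * N 0 0 x + Dt N 0 0 x * N 0 0 x) * v 0 0 x
        + N 0 0 x * N 0 0 x * (- f x * (v 0 0 x * v 0 0 x))).
    { apply is_derive_unique,
        (is_derive_flux (fun t => N t 0 x) (fun t => N t 0 x) (fun t => v t 0 x));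
        [exact (smooth_near_is_derive_t r N 0 0 x HN H0 H0)
        | exact (smooth_near_is_derive_t r N 0 0 x HN H0 H0) | exact Dvt]. }
    unfold E; rewrite Ems, Ent.
    change (mh 0 0 x) with (N 0 0 x * Q u (h 0 0) x * v 0 0 x).
    change (nk 0 0 x) with (P 0 0 x * Q u (k 0 0) x * v 0 0 x).
    rewrite EH, EK, EP, Em, En; unfold Y; field; lra. }
  assert (HEx : forall x, Dx (Dx E) 0 0 x = - (3 / 2 * (J * / I)) * Dx (Dx Y) 0 0 x).
  { intros x; unfold Dx at 1 3; rewrite <- Derive_scal.
    apply Derive_ext; intros y; unfold Dx; rewrite <- Derive_scal.
    apply Derive_ext, HE. }
  assert (CA1 : forall x, continuous A1 x).
  { intros x; rewrite HA1.
    apply continuous_Rminus; [apply continuous_Rminus |].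
    - exact (Cx _ (proj1 (proj2 (proj2 (smooth_near_partials r _ Hwst)))) x).
    - exact (Cx _ (smooth_near_Dx_Dx r _ Hms) x).
    - exact (Cx _ (smooth_near_Dx_Dx r _ Hmh) x). }
  assert (CA2 : forall x, continuous A2 x).
  { intros x; rewrite HA2.
    apply continuous_Rminus; [apply continuous_Rminus |].
    - exact (Cx _ (proj1 (proj2 (smooth_near_partials r _ Hwss))) x).
    - exact (Cx _ (smooth_near_Dx_Dx r _ Hnt) x).
    - exact (Cx _ (smooth_near_Dx_Dx r _ Hnk) x). }
  pose (c := 3 / 2 * (J * / I)).
  (* This constant is never evaluated: in the pairing with [P] it multiplies the weighted mean of
     [Q u f], which is zero. *)
  pose (c' := RInt (fun y => / u y * (c * Dx Y 0 0 y)) 0 1 * / I).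
  assert (HQA : forall x, Q u A1 x - Q u A2 x = c * Dx Y 0 0 x - c').
  { intros x; rewrite Q_minus by assumption.
    replace (fun y => A1 y - A2 y) with (fun y => c * Dx (Dx Y) 0 0 y).
    - apply (Q_derivative u (fun y => c * Dx Y 0 0 y)); auto.
      + intros y; apply (is_derive_scal (Dx Y 0 0) y c).
        exact (smooth_near_is_derive_x r _ 0 0 y HYx H0 H0).
      + intros y; apply continuous_Rmult;
          [apply continuous_const | exact (Cx _ HYxx y)].
    - apply functional_extensionality; intros y.
      rewrite HA, HEx; unfold c; ring. }
  assert (CvP : forall k, (forall x, continuous k x) ->
    forall x, continuous (fun y => / u y * k y * Q u f y) x).
  { intros j Hj x; apply continuous_Rmult; [apply continuous_Rmult |];
      [exact (Cx v Hv x) | apply Hj | exact (Cx P HP x)]. }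
  assert (CQ : forall k, (forall x, continuous k x) -> forall x, continuous (Q u k) x).
  { intros j Hj x; eapply is_derive_continuous, is_derive_Q, Hj. }
  rewrite <- RInt_minus_R by (apply ex_RInt_everywhere, CvP, CQ; assumption).
  assert (Hfin : RInt (fun x => / u x * Q u A1 x * Q u f x - / u x * Q u A2 x * Q u f x) 0 1
    = c * (- / 2 * J)).
  { etransitivity; [apply (RInt_linear3 c (- c') 0
      (fun x => v 0 0 x * P 0 0 x * Dx Y 0 0 x) (fun x => / u x * Q u f x)
      (fun _ => 0)) |].
    - intros x; apply continuous_Rmult; [apply continuous_Rmult |];
        [exact (Cx v Hv x) | exact (Cx P HP x) | exact (Cx _ HYx x)].
    - intros x; apply continuous_Rmult; [exact (Cx v Hv x) | exact (Cx P HP x)].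
    - intros x; apply continuous_const.
    - intros x.
      transitivity (/ u x * (Q u A1 x - Q u A2 x) * Q u f x); [ring |].
      rewrite HQA; change (v 0 0 x) with (/ u x); change (P 0 0 x) with (Q u f x); ring.
    - rewrite HYI, (RInt_inv_Q u f Cu upos (Cx _ Hwt)); ring_R. }
  rewrite Hfin.
  replace (RInt (fun x => (f x * Q u g x - Q u f x * g x) / u x ^ 2) 0 1) with J.
  - fold I; unfold c; field; lra.
  - apply RInt_ext_R; intros x; unfold v, P, N, u, f, g.
    field; apply Rgt_not_eq, upos.
Qed.

(** * Families of forms *)

Lemma coeff_phi (u : R -> R) : coeff (phi u) = u.
Proof.
  apply functional_extensionality; intros x.
  unfold coeff, phi, wedge3, basis_vec; simpl.
  rewrite (Rmult_1_r x); ring.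
Qed.

Lemma coeff_tangent_form (f : R -> R) : coeff (tangent_form f) = f.
Proof.
  apply functional_extensionality; intros x.
  unfold coeff, tangent_form, wedge3, basis_vec; simpl.
  rewrite (Rmult_1_r x); ring.
Qed.

Lemma three_form_ext (a b : three_form) :
  (forall p v1 v2 v3, a p v1 v2 v3 = b p v1 v2 v3) -> a = b.
Proof.
  intros H.
  apply functional_extensionality; intros p; apply functional_extensionality; intros v1.
  apply functional_extensionality; intros v2; apply functional_extensionality; intros v3.
  apply H.
Qed.

(** The hypothesis is local in the parameter because the family is known to lie in [M1] only near
    the origin. The constant part of [phi] drops out under differentiation. *)
Lemma form_deriv_phi (Phi : R -> three_form) (w : R -> R -> R) (t : R) :
  locally t (fun tau => Phi tau = phi (w tau)) ->
  (forall x, ex_derive (fun tau => w tau x) t) ->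
  form_deriv Phi t = tangent_form (fun x => Derive (fun tau => w tau x) t).
Proof.
  intros HPhi Hw; apply three_form_ext; intros p v1 v2 v3.
  unfold form_deriv, tangent_form.
  rewrite (Derive_ext_loc _ (fun tau => phi (w tau) p v1 v2 v3))
    by (revert HPhi; apply filter_imp; intros tau ->; reflexivity).
  unfold phi.
  apply is_derive_unique.
  auto_derive; [auto | ring].
Qed.

Lemma form_deriv_tangent_form (Y : R -> three_form) (g : R -> R -> R) (t : R) :
  locally t (fun tau => Y tau = tangent_form (g tau)) ->
  form_deriv Y t = tangent_form (fun x => Derive (fun tau => g tau x) t).
Proof.
  intros HY; apply three_form_ext; intros p v1 v2 v3.
  unfold form_deriv, tangent_form.
  rewrite (Derive_ext_loc _ (fun tau => - wedge3 theta3 x0 x3 v1 v2 v3 * g tau (p x0)))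
    by (revert HY; apply filter_imp; intros tau ->; unfold tangent_form; ring).
  rewrite Derive_scal; ring.
Qed.

Lemma cov_deriv_tangent_form (Phi Y : R -> three_form) (w g : R -> R -> R) (t : R) :
  locally t (fun tau => Phi tau = phi (w tau)) ->
  (forall x, ex_derive (fun tau => w tau x) t) ->
  locally t (fun tau => Y tau = tangent_form (g tau)) ->
  cov_deriv Phi Y t = tangent_form (fun x => Derive (fun tau => g tau x) t
    - Derive (U (w t) (fun x => Derive (fun tau => w tau x) t) (g t)) x).
Proof.
  intros HPhi Hw HY; apply three_form_ext; intros p v1 v2 v3.
  unfold cov_deriv.
  rewrite (form_deriv_phi Phi w t HPhi Hw), (form_deriv_tangent_form Y g t HY).
  rewrite (locally_singleton _ _ HPhi), (locally_singleton _ _ HY).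
  rewrite coeff_phi, !coeff_tangent_form.
  unfold tangent_form; ring.
Qed.

Lemma family_curvature_coefficients (Phi : R -> R -> three_form) (u f g : R -> R) :
  is_density u -> zero_mean f -> zero_mean g ->
  family_through (phi u) (tangent_form f) (tangent_form g) Phi ->
  family_curvature Phi 0 0
  = 3 / 4 * (RInt (fun x => (f x * Q u g x - Q u f x * g x) / (u x) ^ 2) 0 1) ^ 2
    * / RInt (fun x => / u x) 0 1.
Proof.
  intros Hu Hf Hg ((r & Hr & HM & Hw) & H00 & HX & HY).
  pose (w := fun t s => coeff (Phi t s)).
  change (smooth_near r w) in Hw.
  assert (H0 : Rabs 0 < r) by (rewrite Rabs_R0; exact Hr).
  assert (HPhi : forall t s, Rabs t < r -> Rabs s < r -> Phi t s = phi (w t s)).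
  { intros t s Ht Hs; destruct (HM t s Ht Hs) as (z & _ & E).
    unfold w; rewrite E, coeff_phi; reflexivity. }
  assert (Hpos : forall t s x, Rabs t < r -> Rabs s < r -> 0 < w t s x).
  { intros t s x Ht Hs; destruct (HM t s Ht Hs) as (z & Hz & E).
    unfold w; rewrite E, coeff_phi; apply Hz. }
  assert (Lt : forall t s, Rabs t < r -> Rabs s < r ->
    locally t (fun tau => Phi tau s = phi (w tau s))).
  { intros t s Ht Hs; apply (filter_imp (fun tau => Rabs tau < r));
      [intros; apply HPhi; assumption | apply Rabs_lt_locally, Ht]. }
  assert (Ls : forall t s, Rabs t < r -> Rabs s < r ->
    locally s (fun sigma => Phi t sigma = phi (w t sigma))).
  { intros t s Ht Hs; apply (filter_imp (fun sigma => Rabs sigma < r));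
      [intros; apply HPhi; assumption | apply Rabs_lt_locally, Hs]. }
  assert (Et : forall t s, Rabs t < r -> Rabs s < r ->
    forall x, ex_derive (fun tau => w tau s x) t).
  { intros t s Ht Hs x.
    exact (ex_intro _ _ (smooth_near_is_derive_t r w t s x Hw Ht Hs)). }
  assert (Es : forall t s, Rabs t < r -> Rabs s < r ->
    forall x, ex_derive (fun sigma => w t sigma x) s).
  { intros t s Ht Hs x.
    exact (ex_intro _ _ (smooth_near_is_derive_s r w t s x Hw Ht Hs)). }
  assert (Hdt : forall t s, Rabs t < r -> Rabs s < r ->
    d_t Phi t s = tangent_form (Dt w t s)).
  { intros t s Ht Hs.
    exact (form_deriv_phi (fun tau => Phi tau s) (fun tau => w tau s) t
      (Lt t s Ht Hs) (Et t s Ht Hs)). }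
  assert (Hds : forall t s, Rabs t < r -> Rabs s < r ->
    d_s Phi t s = tangent_form (Ds w t s)).
  { intros t s Ht Hs.
    exact (form_deriv_phi (fun sigma => Phi t sigma) (fun sigma => w t sigma) s
      (Ls t s Ht Hs) (Es t s Ht Hs)). }
  pose (h := fun t s x =>
    Dt (Ds w) t s x - Derive (U (w t s) (Dt w t s) (Ds w t s)) x).
  pose (k := fun t s x =>
    Ds (Ds w) t s x - Derive (U (w t s) (Ds w t s) (Ds w t s)) x).
  (* Known on the whole square, since the outer covariant derivative differentiates this field once
     more. *)
  assert (HDt : forall t s, Rabs t < r -> Rabs s < r ->
    D_t Phi (d_s Phi) t s = tangent_form (h t s)).
  { intros t s Ht Hs.
    refine (cov_deriv_tangent_form (fun tau => Phi tau s) (fun tau => d_s Phi tau s)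
      (fun tau => w tau s) (fun tau => Ds w tau s) t (Lt t s Ht Hs) (Et t s Ht Hs) _).
    apply (filter_imp (fun tau => Rabs tau < r));
      [intros; apply Hds; assumption | apply Rabs_lt_locally, Ht]. }
  assert (HDs : forall t s, Rabs t < r -> Rabs s < r ->
    D_s Phi (d_s Phi) t s = tangent_form (k t s)).
  { intros t s Ht Hs.
    refine (cov_deriv_tangent_form (fun sigma => Phi t sigma) (fun sigma => d_s Phi t sigma)
      (fun sigma => w t sigma) (fun sigma => Ds w t sigma) s
      (Ls t s Ht Hs) (Es t s Ht Hs) _).
    apply (filter_imp (fun sigma => Rabs sigma < r));
      [intros; apply Hds; assumption | apply Rabs_lt_locally, Hs]. }
  assert (HDsDt : D_s Phi (D_t Phi (d_s Phi)) 0 0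
    = tangent_form (fun x => Ds h 0 0 x - Derive (U (w 0 0) (Ds w 0 0) (h 0 0)) x)).
  { refine (cov_deriv_tangent_form (fun sigma => Phi 0 sigma)
      (fun sigma => D_t Phi (d_s Phi) 0 sigma)
      (fun sigma => w 0 sigma) (fun sigma => h 0 sigma) 0
      (Ls 0 0 H0 H0) (Es 0 0 H0 H0) _).
    apply (filter_imp (fun sigma => Rabs sigma < r));
      [intros; apply HDt; assumption | apply Rabs_lt_locally, H0]. }
  assert (HDtDs : D_t Phi (D_s Phi (d_s Phi)) 0 0
    = tangent_form (fun x => Dt k 0 0 x - Derive (U (w 0 0) (Dt w 0 0) (k 0 0)) x)).
  { refine (cov_deriv_tangent_form (fun tau => Phi tau 0)
      (fun tau => D_s Phi (d_s Phi) tau 0)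
      (fun tau => w tau 0) (fun tau => k tau 0) 0 (Lt 0 0 H0 H0) (Et 0 0 H0 H0) _).
    apply (filter_imp (fun tau => Rabs tau < r));
      [intros; apply HDs; assumption | apply Rabs_lt_locally, H0]. }
  (* As [coeff] inverts both [phi] and [tangent_form], equality of forms at the origin determines
     the value and the first partials of [w] there. *)
  assert (Eu : w 0 0 = u) by (unfold w; rewrite H00; apply coeff_phi).
  assert (Ef : Dt w 0 0 = f).
  { rewrite <- (coeff_tangent_form f), <- HX, Hdt by assumption.
    symmetry; apply coeff_tangent_form. }
  assert (Eg : Ds w 0 0 = g).
  { rewrite <- (coeff_tangent_form g), <- HY, Hds by assumption.
    symmetry; apply coeff_tangent_form. }
  assert (Hw01 : w 0 0 0 = w 0 0 1).
  { rewrite Eu, <- (proj1 (proj2 Hu) 0); f_equal; ring. }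
  assert (Hf0 : RInt (Dt w 0 0) 0 1 = 0) by (rewrite Ef; apply Hf).
  assert (Hg0 : RInt (Ds w 0 0) 0 1 = 0) by (rewrite Eg; apply Hg).
  pose proof (curvature_of_coefficients r w Hr Hpos Hw Hw01 Hf0 Hg0) as HK.
  cbv zeta in HK; fold h k in HK.
  unfold family_curvature, metric.
  rewrite HDsDt, HDtDs, Hdt, HPhi by assumption.
  rewrite coeff_phi, !coeff_tangent_form.
  rewrite Eu, Ef, Eg in HK; rewrite Eu, Ef, Eg.
  exact HK.
Qed.

(** * Existence of a family with prescribed velocities *)

Lemma periodic_IZR (u : R -> R) (z : Z) (x : R) :
  periodic u -> u (x + IZR z) = u x.
Proof.
  intros Hu; revert x.
  assert (Hn : forall (n : nat) x, u (x + INR n) = u x).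
  { induction n as [| n IH]; intros x.
    - f_equal; simpl; ring.
    - rewrite S_INR, <- (IH x), <- (Hu (x + INR n)); f_equal; ring. }
  destruct z as [| p | p]; intros x.
  - f_equal; ring.
  - change (IZR (Z.pos p)) with (IPR p); rewrite <- INR_IPR; apply Hn.
  - change (IZR (Z.neg p)) with (- IPR p).
    rewrite <- (Hn (Pos.to_nat p) (x + - IPR p)), INR_IPR; f_equal; ring.
Qed.

Lemma smooth_plus (f g : R -> R) :
  smooth f -> smooth g -> smooth (fun x => f x + g x).
Proof.
  intros Hf Hg n x.
  apply ex_derive_n_plus; apply filter_forall; intros y k _; [apply Hf | apply Hg].
Qed.

Lemma smooth_scal (c : R) (f : R -> R) : smooth f -> smooth (fun x => c * f x).
Proof. intros Hf n x; apply ex_derive_n_scal_l, Hf. Qed.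

(** Zero means keep the total mass equal to 1. Positivity needs one radius for all [x]: compactness
    gives it on [[0, 1]], and periodicity carries it to the whole line. *)
Lemma is_density_perturb (u f g : R -> R) :
  is_density u -> zero_mean f -> zero_mean g ->
  exists r, 0 < r /\ forall t s, Rabs t < r -> Rabs s < r ->
    is_density (fun x => u x + t * f x + s * g x).
Proof.
  intros (Su & Pu & upos & Iu) (Sf & Pf & If) (Sg & Pg & Ig).
  assert (Hc : forall k, smooth k -> forall x, continuous k x).
  { intros k Hk x; apply (ex_derive_continuous k), (Hk 1%nat). }
  assert (Hw : forall n, Cn_near n 1 (fun t s x => u x + t * f x + s * g x)).
  { intros n; repeat (apply Cn_near_plus || apply Cn_near_mult);
      auto using Cn_near_t, Cn_near_s, Cn_near_x. }
  destruct (continuity_ab_min u 0 1) as (y & Hy & _); [lra | |].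
  { intros x _; apply continuity_pt_filterlim, Hc, Su. }
  (* The tolerance [u y] is the minimum of [u] on [[0, 1]], so a smaller perturbation cannot reach
     zero. *)
  destruct (continuous3_tube (fun t s x => u x + t * f x + s * g x) 0 0 0 1)
    with (eps := mkposreal _ (upos y)) as (d & Hd).
  { intros x _; apply (Cn_near_continuous 0 1); [apply Hw | |]; rewrite Rabs_R0; lra. }
  exists d; split; [apply cond_pos |]; intros t s Ht Hs.
  split; [| split; [| split]].
  - exact (smooth_plus _ _ (smooth_plus _ _ Su (smooth_scal t f Sf)) (smooth_scal s g Sg)).
  - intros x; rewrite Pu, Pf, Pg; reflexivity.
  - intros x.
    assert (Hx : 0 <= frac_part x <= 1).
    { destruct (base_fp x); lra. }
    assert (E : forall k, periodic k -> k x = k (frac_part x)).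
    { intros k Hk; rewrite <- (periodic_IZR k (Int_part x) (frac_part x) Hk).
      f_equal; unfold frac_part; ring. }
    rewrite (E u Pu), (E f Pf), (E g Pg).
    assert (H : Rabs (u (frac_part x) + t * f (frac_part x) + s * g (frac_part x)
      - (u (frac_part x) + 0 * f (frac_part x) + 0 * g (frac_part x))) < u y).
    { apply Hd; [| | exact Hx]; rewrite Rminus_0_r; assumption. }
    apply Rabs_def2 in H; pose proof (Hy _ Hx); lra.
  - rewrite (RInt_linear3 1 t s u f g), Iu, If, Ig; auto.
    + ring_R.
    + intros x; ring.
Qed.

(** The affine family works: the constraints on a density are linear apart from positivity, which is
    an open condition on the circle. *)
Lemma family_through_exists (u f g : R -> R) :
  is_density u -> zero_mean f -> zero_mean g ->
  exists Phi, family_through (phi u) (tangent_form f) (tangent_form g) Phi.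
Proof.
  intros Hu Hf Hg.
  exists (fun t s => phi (fun x => u x + t * f x + s * g x)).
  split; [| split; [| split]].
  - destruct (is_density_perturb u f g Hu Hf Hg) as (r & Hr & Hdens).
    exists r; split; [exact Hr | split].
    + intros t s Ht Hs; eexists; split; [exact (Hdens t s Ht Hs) | reflexivity].
    + intros n.
      apply Cn_near_ext with (fun t s x => u x + t * f x + s * g x).
      * intros t s x _ _; rewrite coeff_phi; reflexivity.
      * destruct Hu as (Su & _), Hf as (Sf & _), Hg as (Sg & _).
        repeat (apply Cn_near_plus || apply Cn_near_mult);
          auto using Cn_near_t, Cn_near_s, Cn_near_x.
  - f_equal; apply functional_extensionality; intros x; ring.
  - unfold d_t; rewrite (form_deriv_phi _ (fun t x => u x + t * f x + 0 * g x)).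
    + f_equal; apply functional_extensionality; intros x.
      apply is_derive_unique; auto_derive; [auto | ring].
    + apply filter_forall; reflexivity.
    + intros x; auto_derive; auto.
  - unfold d_s; rewrite (form_deriv_phi _ (fun s x => u x + 0 * f x + s * g x)).
    + f_equal; apply functional_extensionality; intros x.
      apply is_derive_unique; auto_derive; [auto | ring].
    + apply filter_forall; reflexivity.
    + intros x; auto_derive; auto.
Qed.

Theorem proposition5p25 (u f g : R -> R)
  (hu : is_density u) (hf : zero_mean f) (hg : zero_mean g) :
  exists K : R,
    is_sectional_curvature (phi u) (tangent_form f) (tangent_form g) K /\
    K = 3 / 4
        * (RInt (fun x => (f x * Q u g x - Q u f x * g x) / (u x) ^ 2) 0 1) ^ 2
        * / RInt (fun x => / u x) 0 1 /\
    0 <= K.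
Proof.
  eexists; split; [split | split; [reflexivity |]].
  - apply family_through_exists; assumption.
  - intros Phi HPhi; apply family_curvature_coefficients; assumption.
  - destruct hu as (Su & _ & upos & _).
    apply Rmult_le_pos; [apply Rmult_le_pos; [lra | apply pow2_ge_0] |].
    apply Rlt_le, Rinv_0_lt_compat, RInt_inv_pos; [| exact upos].
    intros x; apply (ex_derive_continuous u), (Su 1%nat).
Qed.
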